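(* Let $X^*$ be an $N$-dimensional $DC_0$ Riemannian manifold with atlas $(U_\alpha,\phi_\alpha)_{\alpha\in\Lambda}$ and let $S=\{S_\alpha\}$ be a covariant $p$-tensor defined on an open set $\Omega\subset X^*$ with $\mathcal{GM}(\Omega)$ components. Then the family of local norms $(|S_\alpha|_g)_{\alpha\in\Lambda}$ is a system of $\mathcal{GM}$ measures on $\Omega$, i.e. $|S_\alpha|_g\in\mathcal{GM}(\phi_\alpha(U_\alpha\cap\Omega))$ and $F^*(|S_\beta|_g)=|S_\alpha|_g$ in $\phi_\alpha(U_\alpha\cap U_\beta\cap\Omega)$ for every transition map $F=\phi_\beta\circ\phi_\alpha^{-1}$. Thus it induces a measure $|S|_g\in\mathcal{GM}(\Omega)$, called the norm of $S$, defined by $$|S|_g(B)=\int_{\phi_\alpha(B)}\sqrt{\det G_\alpha(x)}\,d|S_\alpha|_g(x)\qquad\text{for any Borel set }B\subset U_\alpha\cap\Omega,$$ where $G_\alpha$ is the matrix of the metric read in the chart $(U_\alpha,\phi_\alpha)$.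
   Context: Function classes. Let $\Omega\subset\mathbb R^N$ be open; $\mathcal H^k$ is $k$-dimensional Hausdorff measure. $f:\Omega\to\mathbb R$ is DC if it is locally a difference of two semiconcave functions. $f\in C_{w,o}(\Omega,S)$ if $S$ is $\mathcal H^{N-1}$-negligible, $f|_{\Omega\setminus S}$ is continuous, and every $x\in\Omega$ has a ball $B_r(x)$ compactly contained in $\Omega$ with $\sup_{B_r(x)\setminus S}|f|<\infty$. $\mathcal{BV}_0(\Omega,S)=BV_{loc}(\Omega)\cap C_{w,o}(\Omega,S)$. $DC_0(\Omega,S)$ is the set of DC functions whose gradient has components in $C_{w,o}(\Omega,S)$. $\mathcal{GM}(\Omega)$ is the set of (signed) Radon measures on $\Omega$ vanishing on $\mathcal H^{N-1}$-negligible sets (on a manifold: read in every chart via push-forward). $DC_0$ Riemannian manifold. A $\sigma$-compact $N$-dimensional topological manifold $X^*$ with a singular set $\mathcal S\subset X^*$ and a maximal atlas $(U_\alpha,\phi_\alpha)_{\alpha\in\Lambda}$ (homeomorphisms onto open subsets of $\mathbb R^N$) such that $\phi_\alpha(U_\alpha\cap\mathcal S)$ is $\mathcal H^{N-1}$-negligible and every transition map $F=\phi_\beta\circ\phi_\alpha^{-1}:\phi_\alpha(U_\alpha\cap U_\beta)\to\phi_\beta(U_\alpha\cap U_\beta)$ has components in $DC_0(\phi_\alpha(U_\alpha\cap U_\beta),\phi_\alpha(U_\alpha\cap\mathcal S))$; and with a Riemannian metric $g$ on $X^*\setminus\mathcal S$ (a covariant 2-tensor, so that for a transition map $F$ the matrices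 satisfy $G_\alpha={}^t(dF)(G_\beta\circ F)(dF)$) whose components in any chart $(U,\phi)$ belong to $\mathcal{BV}_0(\phi(U),\phi(U\cap\mathcal S))$ and satisfy $c(x)^{-1}\|p\|_2^2\ge\sum g_{ij}(x)p_ip_j\ge c(x)\|p\|_2^2$ for all $p\in\mathbb R^N$, $x\in\phi(U\setminus\mathcal S)$, with $c,c^{-1}$ locally bounded in $\phi(U)$. Pull-backs and tensors. For a transition map $F:\hat U\to\hat V$ and $\mu\in\mathcal{GM}(\hat V)$, $F^*\mu=(F^{-1})_\sharp(|\det dF^{-1}|\,\mu)$. A covariant $p$-tensor $S$ on an open $\Omega\subset X^*$ with $\mathcal{GM}$ components is a family $S_\alpha=\sum S_{\alpha,j_1\cdots j_p}dy^{j_1}\otimes\cdots\otimes dy^{j_p}$ with $S_{\alpha,j_1\cdots j_p}\in\mathcal{GM}(\phi_\alpha(U_\alpha\cap\Omega))$ such that, for all $\alpha,\beta$ and $F=\phi_\beta\circ\phi_\alpha^{-1}$, $S_{\alpha,i_1\cdots i_p}=\sum_{j_1,\dots,j_p}\frac{\partial F_{j_1}}{\partial x_{i_1}}\cdots\frac{\partial F_{j_p}}{\partial x_{i_p}}F^*(S_{\beta,j_1\cdots j_p})$ in $\phi_\alpha(U_\alpha\cap U_\beta\cap\Omega)$. Evaluation on vector fields $X_1,\dots,X_p$ with $C_{w,o}$ components: $S_\alpha(X_1,\dots,X_p)=\sum_{\underline j}X_1^{j_1}\cdots X_p^{j_p}S_{\alpha,\underline j}$. Local norm. In the chart $(U_\alpha,\phi_\alpha)$,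 choose vector fields $(E_i)_{1\le i\le N}$ with components in $C_{w,o}(\phi_\alpha(U_\alpha\cap\Omega),\phi_\alpha(U_\alpha\cap\mathcal S))$ forming a $g$-orthonormal frame (such frames exist by Gram–Schmidt). $|S_\alpha|_g$ is the total variation (w.r.t. the Euclidean norm of $\mathbb R^{N^p}$) of the $\mathbb R^{N^p}$-valued measure $(S_\alpha(E_{i_1},\dots,E_{i_p}))_{(i_1,\dots,i_p)}$; this does not depend on the choice of frame. *)

(* Defs.v *)
From HB Require Import structures.
From mathcomp Require Import all_boot all_order all_algebra.
From mathcomp Require Import all_classical all_reals all_analysis.

Set Implicit Arguments.
Unset Strict Implicit.
Unset Printing Implicit Defensive.

Import Order.TTheory GRing.Theory Num.Theory.
Import numFieldNormedType.Exports.

Local Open Scope classical_set_scope.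
Local Open Scope ring_scope.

(* The space R^N is 'rV[R]_N.  Its library norm is the sup norm, so the
   Euclidean norm and balls are defined separately.  The library Jacobian acts
   on row vectors: ('J F x) i j is the derivative of F_j along x_i, that is,
   'J F x is the transpose of the matrix dF. *)

Notation borel T := (g_sigma_algebraType (@open T)).
Notation borel_rV R N := (g_sigma_algebraType (@open 'rV[R]_N)).

Section Euclidean.
Context {R : realType} {N : nat}.
Local Notation E := 'rV[R]_N.

Definition enorm (x : E) : R := Num.sqrt (\sum_(i < N) x ord0 i ^+ 2).

Definition eball (x : E) (r : R) : set E := [set y | enorm (y - x) < r].

Definition compactly_contained (A Omega : set E) : Prop :=
  compact (closure A) /\ closure A `<=` Omega.

Definition ediam (A : set E) : \bar R :=
  ereal_sup [set (enorm (x - y))%:E | x in A & y in A].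

(* (diam A)^k, with 0^0 = 1 for a nonempty A, and 0 for the empty set *)
Definition diam_pow (k : nat) (A : set E) : \bar R :=
  if A == set0 then 0%E else (ediam A ^+ k)%E.

(* Hausdorff outer measure without its dimensional constant: it is used
   through its null sets only. *)
Definition hausdorff (k : nat) (A : set E) : \bar R :=
  ereal_sup [set ereal_inf [set (\sum_(h <oo) diam_pow k (C h))%E | C in
      [set C : nat -> set E | A `<=` \bigcup_h C h /\
                              forall h, (ediam (C h) <= delta%:E)%E]]
    | delta in [set delta : R | 0 < delta]].

(* negligible for the (N-1)-dimensional Hausdorff measure *)
Definition hnegligible (A : set E) : Prop := hausdorff N.-1 A = 0%E.

(* Lebesgue outer measure, by covers with closed boxes; on Borel sets it is the
   N-dimensional Lebesgue measure. *)
Definition lebesgue_rV (A : set (borel_rV R N)) : \bar R :=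
  ereal_inf [set (\sum_(h <oo) (\prod_(i < N)
                     ((ab h).2 ord0 i - (ab h).1 ord0 i))%:E)%E | ab in
    [set ab : nat -> E * E |
      (forall h i, (ab h).1 ord0 i <= (ab h).2 ord0 i) /\
      A `<=` \bigcup_h [set x | forall i,
               (ab h).1 ord0 i <= x ord0 i <= (ab h).2 ord0 i]]].

(* Function classes on an open set Omega.  Functions are total; their values
   outside Omega, and on S where S occurs, are never used. *)

Definition locally_bounded (Omega : set E) (f : E -> R) : Prop :=
  forall x, Omega x -> exists C : R, \forall y \near x, `|f y| <= C.

Definition Cwo (Omega S : set E) (f : E -> R) : Prop :=
  [/\ hnegligible S,
      {within Omega `\` S, continuous f} &
      forall x, Omega x -> exists r : R,
        [/\ 0 < r, compactly_contained (eball x r) Omega &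
            exists C : R, forall y, (eball x r `\` S) y -> `|f y| <= C]].

(* u is semiconcave on the convex set A: u - C/2 |.|^2 is concave on A *)
Definition semiconcave (A : set E) (u : E -> R) : Prop :=
  exists C : R,
    @convex_function R E A (fun x => C / 2 * enorm x ^+ 2 - u x).

Definition DC (Omega : set E) (f : E -> R) : Prop :=
  forall x, Omega x -> exists r : R,
    [/\ 0 < r, eball x r `<=` Omega &
        exists u v : E -> R,
          [/\ semiconcave (eball x r) u, semiconcave (eball x r) v &
              forall y, eball x r y -> f y = u y - v y]].

Definition partial (f : E -> R^o) (i : 'I_N) (x : E) : R :=
  'D_(delta_mx ord0 i) f x.

(* The gradient has to be a function continuous on Omega `\` S, so it is
   required to exist at every point of that set. *)
Definition DC0 (Omega S : set E) (f : E -> R^o) : Prop :=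
  [/\ DC Omega f,
      forall x, (Omega `\` S) x -> differentiable f x &
      forall i, Cwo Omega S (partial f i)].

(* compactly supported C^1 vector fields in A, of Euclidean norm at most 1 *)
Definition test_field (A : set E) : set (E -> E) :=
  [set psi | [/\ forall x, differentiable psi x,
                 forall i j, continuous (fun x => ('J psi x) i j),
                 compactly_contained [set x | psi x != 0] A &
                 forall x, enorm (psi x) <= 1]].

(* the variation of v in A: the supremum of the integrals of v div psi *)
Definition variation (v : E -> R) (A : set E) : \bar R :=
  ereal_sup [set (\int[lebesgue_rV]_(x in A) (v x * \tr ('J psi x))%:E)%E
            | psi in test_field A].

(* v is a Borel representative of the almost everywhere class of f *)
Definition BVloc (Omega : set E) (f : E -> R) : Prop :=
  exists v : borel_rV R N -> R,
    [/\ {ae lebesgue_rV, forall x, Omega x -> f x = v x},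
        forall K : set E, compact K -> K `<=` Omega ->
          lebesgue_rV.-integrable K (EFin \o v) &
        forall A : set E, open A -> compactly_contained A Omega ->
          (variation v A < +oo)%E].

Definition BV0 (Omega S : set E) (f : E -> R) : Prop :=
  BVloc Omega f /\ Cwo Omega S f.

End Euclidean.

Section Radon.
Context {R : realType} {N : nat}.
Local Notation E := 'rV[R]_N.
Local Notation setfun := (set (borel_rV R N) -> \bar R).

(* A signed Radon measure on Omega is a set function on the Borel sets that are
   compactly contained in Omega, which is a (finite) signed measure on the Borel
   subsets of every compact subset of Omega; total variation on Omega may be
   infinite.  The values on other sets are irrelevant: Radon measures are
   compared with radon_eq. *)
Definition radon (Omega : set E) (mu : setfun) : Prop :=
  forall K : set E, compact K -> K `<=` Omega ->
    exists nu : {charge set (borel_rV R N) -> \bar R},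
      forall B : set (borel_rV R N), measurable B -> B `<=` K -> mu B = nu B.

Definition radon_eq (Omega : set E) (mu nu : setfun) : Prop :=
  forall B : set (borel_rV R N), measurable B ->
    compactly_contained B Omega -> mu B = nu B.

Definition GM (Omega : set E) (mu : setfun) : Prop :=
  radon Omega mu /\
  forall B : set (borel_rV R N), measurable B ->
    compactly_contained B Omega -> hnegligible B -> mu B = 0%E.

(* the Jordan decomposition of mu into its positive and negative variations *)
Definition pos_var (mu : setfun) : setfun := fun A =>
  ereal_sup [set mu B | B in
    [set B : set (borel_rV R N) | measurable B /\ B `<=` A]].

Definition neg_var (mu : setfun) : setfun := pos_var (fun A => (- mu A)%E).

(* The measure h mu.  When mu is GM and h is Cwo with singular set S, the values
   of h on S do not matter, even if S is not Borel: S lies in a Borel null set,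
   and the library integral of a nonnegative function is the supremum of the
   integrals of the simple functions below it. *)
Definition density (h : E -> R) (mu : setfun) : setfun := fun B =>
  (\int[pos_var mu]_(x in B) (h x)%:E - \int[neg_var mu]_(x in B) (h x)%:E)%E.

(* Total variation in Omega of the vector-valued Radon measure (m i)_i for the
   Euclidean norm, by countable Borel partitions.  It is meant for Borel sets B,
   on which it is the restriction to Omega, extended by 0 outside. *)
Definition total_variation (I : finType) (Omega : set E) (m : I -> setfun) :
    setfun := fun B =>
  ereal_sup [set (\sum_(h <oo)
                    (Num.sqrt (\sum_(i : I) fine (m i (P h)) ^+ 2))%:E)%E | P in
    [set P : nat -> set (borel_rV R N) |
      [/\ forall h, measurable (P h),
          forall h, compactly_contained (P h) Omega,
          trivIset setT P & \bigcup_h P h = B `&` Omega]]].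

End Radon.

(* push-forward under f of a measure mu on D, for f defined on D only *)
Definition push {R : realType} {T1 T2 : Type} (D : set T1) (f : T1 -> T2)
    (mu : set T1 -> \bar R) : set T2 -> \bar R :=
  fun A => mu (D `&` f @^-1` A).

(* F^* mu for mu on V, where Finv is the inverse of F, defined on V *)
Definition pullback {R : realType} {N : nat} (V : set 'rV[R]_N)
    (Finv : 'rV[R]_N -> 'rV[R]_N) (mu : set (borel_rV R N) -> \bar R) :
    set (borel_rV R N) -> \bar R :=
  push V Finv (density (fun y => `|\det ('J Finv y)|) mu).

(* X is pointed because library measurable spaces are. *)
Record chart (R : realType) (N : nat) (X : ptopologicalType) := Chart {
  cdom : set X;
  cmap : X -> 'rV[R]_N;
  cinv : 'rV[R]_N -> X }.

Section Charts.
Context {R : realType} {N : nat} {X : ptopologicalType}.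
Implicit Types c d : chart R N X.

(* cmap is a homeomorphism from the open set cdom onto an open set, with
   inverse cinv *)
Definition is_chart c : Prop :=
  [/\ open (cdom c) /\ open (cmap c @` cdom c),
      forall x, cdom c x -> cinv c (cmap c x) = x,
      {within cdom c, continuous (cmap c)} &
      {within cmap c @` cdom c, continuous (cinv c)}].

Definition transition c d : 'rV[R]_N -> 'rV[R]_N := cmap d \o cinv c.

Definition DC0_transition (S : set X) c d : Prop :=
  forall j : 'I_N, DC0 (cmap c @` (cdom c `&` cdom d)) (cmap c @` (cdom c `&` S))
                       (fun x => transition c d x ord0 j).

End Charts.

Record DC0_manifold (R : realType) (N : nat) := DC0Manifold {
  carrier :> ptopologicalType;
  sing : set carrier;
  index : Type;
  atlas : index -> chart R N carrier;
  (* the matrix of the metric in each chart; only its values off the image of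
     the singular set matter *)
  metric : index -> 'rV[R]_N -> 'M[R]_N;

  carrier_hausdorff : hausdorff_space carrier;
  carrier_sigma_compact : exists K : nat -> set carrier,
    (forall n, compact (K n)) /\ \bigcup_n K n = setT;
  atlas_chart : forall a, is_chart (atlas a);
  atlas_cover : \bigcup_a cdom (atlas a) = setT;
  atlas_sing : forall a,
    hnegligible (cmap (atlas a) @` (cdom (atlas a) `&` sing));
  atlas_DC0 : forall a b, DC0_transition sing (atlas a) (atlas b);
  atlas_maximal : forall c : chart R N carrier,
    is_chart c -> hnegligible (cmap c @` (cdom c `&` sing)) ->
    (forall a, DC0_transition sing (atlas a) c /\
               DC0_transition sing c (atlas a)) ->
    exists a, cdom (atlas a) = cdom c /\
              forall x, cdom c x -> cmap (atlas a) x = cmap c x;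

  metric_sym : forall a x,
    (cmap (atlas a) @` (cdom (atlas a) `\` sing)) x ->
    (metric a x)^T = metric a x;
  metric_transform : forall a b x,
    (cmap (atlas a) @` ((cdom (atlas a) `&` cdom (atlas b)) `\` sing)) x ->
    let F := transition (atlas a) (atlas b) in
    metric a x = 'J F x *m metric b (F x) *m ('J F x)^T;
  metric_BV0 : forall a i j,
    BV0 (cmap (atlas a) @` cdom (atlas a))
        (cmap (atlas a) @` (cdom (atlas a) `&` sing))
        (fun x => metric a x i j);
  metric_elliptic : forall a, exists c : 'rV[R]_N -> R,
    [/\ forall x, (cmap (atlas a) @` cdom (atlas a)) x -> 0 < c x,
        locally_bounded (cmap (atlas a) @` cdom (atlas a)) c,
        locally_bounded (cmap (atlas a) @` cdom (atlas a)) (fun x => (c x)^-1) &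
        forall x (p : 'rV[R]_N),
          (cmap (atlas a) @` (cdom (atlas a) `\` sing)) x ->
          c x * enorm p ^+ 2 <= (p *m metric a x *m p^T) ord0 ord0
                             <= (c x)^-1 * enorm p ^+ 2] }.

Section Tensors.
Context {R : realType} {N : nat} (M : DC0_manifold R N).
Local Notation setfun := (set (borel_rV R N) -> \bar R).

Definition dom (a : index M) : set M := cdom (atlas a).
Definition phi (a : index M) : M -> 'rV[R]_N := cmap (atlas a).
Definition trans (a b : index M) : 'rV[R]_N -> 'rV[R]_N :=
  transition (atlas a) (atlas b).
Definition csing (a : index M) : set 'rV[R]_N := phi a @` (dom a `&` @sing R N M).

Variable Omega : set M.

Definition cOmega (a : index M) : set 'rV[R]_N := phi a @` (dom a `&` Omega).

(* the part of Omega in the domains of two charts, read in the first one *)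
Definition overlap (a b : index M) : set 'rV[R]_N :=
  phi a @` (dom a `&` dom b `&` Omega).

(* F^* for F = trans a b, between the overlaps inside Omega *)
Definition chart_pullback (a b : index M) (mu : setfun) : setfun :=
  pullback (overlap b a) (trans b a) mu.

Definition GM_system (mu : index M -> setfun) : Prop :=
  (forall a, GM (cOmega a) (mu a)) /\
  (forall a b, radon_eq (overlap a b) (chart_pullback a b (mu b)) (mu a)).

(* GM on a manifold: a Borel measure on Omega (extended by 0 outside) all of
   whose chart readings are GM *)
Definition GM_manifold (nu : {measure set (borel M) -> \bar R}) : Prop :=
  nu (~` Omega) = 0%E /\
  forall a, GM (cOmega a) (push (dom a `&` Omega) (phi a) nu).

Variable p : nat.

(* components S_(a, j_1 ... j_p) of a covariant p-tensor, j : 'I_p -> 'I_N *)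
Definition components := index M -> {ffun 'I_p -> 'I_N} -> setfun.

Definition is_tensor (S : components) : Prop :=
  (forall a j, GM (cOmega a) (S a j)) /\
  forall a b (i : {ffun 'I_p -> 'I_N}),
    radon_eq (overlap a b) (S a i)
      (fun B => \sum_(j : {ffun 'I_p -> 'I_N})
         density (fun x => (\prod_(k < p) ('J (trans a b) x) (i k) (j k))%R)
                 (chart_pullback a b (S b j)) B)%E.

(* S_a (X_1, ..., X_p) *)
Definition tensor_eval (S : components) (a : index M)
    (X : 'I_p -> 'rV[R]_N -> 'rV[R]_N) : setfun := fun B =>
  (\sum_(j : {ffun 'I_p -> 'I_N})
     density (fun x => (\prod_(k < p) X k x ord0 (j k))%R) (S a j) B)%E.

Definition orthonormal_frame (a : index M) :
    set ('I_N -> 'rV[R]_N -> 'rV[R]_N) :=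
  [set F : 'I_N -> 'rV[R]_N -> 'rV[R]_N |
           (forall i j, Cwo (cOmega a) (csing a) (fun x => F i x ord0 j)) /\
           forall x, (cOmega a `\` csing a) x -> forall i j,
             (F i x *m metric a x *m (F j x)^T) ord0 ord0 = (i == j)%:R].

(* a chosen orthonormal frame *)
Definition frame (a : index M) : 'I_N -> 'rV[R]_N -> 'rV[R]_N :=
  xget (fun _ _ => 0) (orthonormal_frame a).

(* |S_a|_g *)
Definition local_norm (S : components) (a : index M) : setfun :=
  total_variation (cOmega a)
    (fun i : {ffun 'I_p -> 'I_N} =>
       tensor_eval S a (fun k => frame a (i k))).

(* the formula that defines |S|_g *)
Definition norm_formula (S : components)
    (nu : {measure set (borel M) -> \bar R}) : Prop :=
  forall a (B : set (borel M)), measurable B -> B `<=` dom a `&` Omega ->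
    nu B = (\int[local_norm S a]_(x in phi a @` B)
              (Num.sqrt (\det (metric a x)))%:E)%E.

End Tensors.

(* Main.v *)
Require Import Defs.
From HB Require Import structures.
From mathcomp Require Import all_boot all_order all_algebra.
From mathcomp Require Import all_classical all_reals all_analysis.
From mathcomp Require Import measurable_realfun ring lra.

(* On a compact subset of a chart the components of the tensor have densities
   f_j with respect to a common finite measure (Radon-Nikodym), and every
   measure in the statement inherits one: the local norm has density the
   Euclidean norm of the components read in the orthonormal frame.  A transition
   map F transports the reference measure; by the chain rule it multiplies the
   component densities by |det dF^{-1}| and products of entries of dF, and it
   carries one g-orthonormal frame to the other up to an orthogonal matrix, which
   acts isometrically on p-tensors.  Hence the local norms are related by F^*, and
   since sqrt(det G_a) |det dF^{-1}| = sqrt(det G_b) o F the measures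
   sqrt(det G_a) |S_a|_g agree on overlaps; they are glued along a countable atlas.
   The singular set is contained in a Borel H^{N-1}-negligible set, so that it can
   be removed throughout. *)

Set Implicit Arguments.
Unset Strict Implicit.
Unset Printing Implicit Defensive.

Import Order.TTheory GRing.Theory Num.Theory.
Import numFieldNormedType.Exports.

Local Open Scope classical_set_scope.
Local Open Scope ring_scope.

Import HBNNSimple.

(** * Integration against set functions *)

(** This is the purpose of [has_density]: on a compact K it replaces a set function by a pointwise
    function, and an identity of measures by an identity of functions off an exceptional set Z. The
    set Z is carried as a parameter because frames, Jacobians and the metric are controlled only off
    the singular set, which need not be Borel. Densities change with the compact; only identities
    between set functions survive the passage to open sets, which is made by countable additivity
    along exhaustions. For the total variation this additivity has to be established beforehand,
    since its definition admits only partitions into compactly contained pieces. *)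

Section RawIntegral.
Local Open Scope ereal_scope.
Context d (T : measurableType d) (R : realType).
Implicit Types (D Z : set T) (mu : set T -> \bar R).

Let nnsub D (h : {nnsfun T >-> R}) (F : T -> \bar R) :
  (forall x, (h x)%:E <= F x) -> (forall x, ~ D x -> F x = 0) ->
  forall r : R, r != 0%R -> h @^-1` [set r] `<=` D.
Proof.
move=> hF FD r r0 x /= hxr; apply: contrapT => nDx.
have := hF x; rewrite (FD _ nDx) lee_fin => h0.
by move: r0; rewrite -hxr eq_le h0 fun_ge0.
Qed.

(** Nonzero level sets of h lie in D, where mu and m agree, and cutting h off on Z costs them only
    an m-null part. The level 0, on which mu may take any value, enters with factor 0. *)
Let sintegral_agree (m : {measure set T -> \bar R}) mu D Z (h : {nnsfun T >-> R})
    (mZ : measurable Z) (F : T -> \bar R) :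
  (forall x, (h x)%:E <= F x) -> (forall x, ~ D x -> F x = 0) ->
  measurable D ->
  m (D `&` Z) = 0 ->
  (forall A, measurable A -> A `<=` D -> mu A = m A) ->
  let h' := mul_nnsfun h (indic_nnsfun R (measurableC mZ)) in
  sintegral mu h = sintegral m h' /\ sintegral m h = sintegral mu h'.
Proof.
move=> hF FD mD mDZ agree h'.
have sub := nnsub hF FD.
have h'E x : h' x = (h x * \1_(~` Z) x)%R by [].
have mh' : forall r : R, r != 0%R -> h' @^-1` [set r] = h @^-1` [set r] `\` Z.
  move=> r r0; apply/seteqP; split=> x /=.
    rewrite /measurable_realfun.mindic indicE; case: (boolP (x \in ~` Z)).
      by rewrite inE mulr1.
    by rewrite mulr0 => _ E; rewrite -E eqxx in r0.
  by move=> -[hx nZ]; rewrite /measurable_realfun.mindic indicE mem_set//= mulr1.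
have key : forall r : R, r != 0%R -> m (h @^-1` [set r] `\` Z) = m (h @^-1` [set r]).
  move=> r r0.
  have mh : measurable (h @^-1` [set r]) by exact: measurable_sfunP.
  have E : m (h @^-1` [set r] `&` Z) = 0.
    apply/eqP; rewrite eq_le measure_ge0 andbT -mDZ le_measure ?inE//.
    - exact: measurableI.
    - exact: measurableI.
    - by apply: setSI; exact: sub.
  by rewrite [RHS](measureDI m mh mZ) [X in _ + X]E adde0.
split; rewrite !sintegralET; apply: eq_fsbigr => r _.
- have [->|r0] := eqVneq r 0%R; first by rewrite !mul0e.
  by rewrite mh'// key// agree//; exact: sub.
- have [->|r0] := eqVneq r 0%R; first by rewrite !mul0e.
  rewrite mh'// -key// agree//; first exact: measurableD.
  by apply: subset_trans (sub _ r0); exact: subDsetl.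
Qed.

(* The library integral of an arbitrary set function is a supremum over simple
   functions, so it only depends on the values of mu on Borel subsets of D, and
   f may be changed on a null set even if it is not measurable there. *)
Lemma raw_integral (m : {measure set T -> \bar R}) mu D Z (f g : T -> \bar R) :
  measurable D -> measurable Z -> m (D `&` Z) = 0 ->
  (forall A, measurable A -> A `<=` D -> mu A = m A) ->
  (forall x, D x -> ~ Z x -> f x = g x) ->
  \int[mu]_(x in D) f x = \int[m]_(x in D) g x.
Proof.
move=> mD mZ mDZ agree fg.
suff nn (F G : T -> \bar R) : (forall x, 0 <= F x) -> (forall x, 0 <= G x) ->
   (forall x, ~ D x -> F x = 0) -> (forall x, ~ D x -> G x = 0) ->
   (forall x, D x -> ~ Z x -> F x = G x) ->
   ereal_sup [set sintegral mu h | h in [set h : {nnsfun T >-> R} | forall x, (h x)%:E <= F x]] =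
   ereal_sup [set sintegral m h | h in [set h : {nnsfun T >-> R} | forall x, (h x)%:E <= G x]].
  rewrite /integral; congr (_ - _); apply: nn.
  - by move=> x; exact: funepos_ge0.
  - by move=> x; exact: funepos_ge0.
  - by move=> x nD; rewrite funeposE patchE memNset// maxxx.
  - by move=> x nD; rewrite funeposE patchE memNset// maxxx.
  - by move=> x Dx nZ; rewrite !funeposE !patchE !mem_set// fg.
  - by move=> x; exact: funeneg_ge0.
  - by move=> x; exact: funeneg_ge0.
  - by move=> x nD; rewrite funenegE patchE memNset// oppe0 maxxx.
  - by move=> x nD; rewrite funenegE patchE memNset// oppe0 maxxx.
  - by move=> x Dx nZ; rewrite !funenegE !patchE !mem_set// fg.
(* F and G agree off Z, so a simple function below one of them, cut off on Z, lies below the other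
   and keeps its integral. *)
move=> F0 G0 FD GD FG; apply/eqP; rewrite eq_le; apply/andP; split;
  apply: ge_ereal_sup => _ [h /= hF <-]; apply: ereal_sup_ubound.
- have [E1 E2] := sintegral_agree mZ hF FD mD mDZ agree.
  eexists; last by rewrite E1; reflexivity.
  move=> x /=; rewrite /measurable_realfun.mindic indicE; case: (boolP (x \in ~` Z)); last first.
    by rewrite mulr0.
  rewrite inE mulr1 => nZ.
  have [Dx|nD] := pselect (D x); first by rewrite -FG.
  by rewrite GD//  -(FD _ nD).
- have [E1 E2] := sintegral_agree mZ hF GD mD mDZ agree.
  eexists; last by rewrite E2; reflexivity.
  move=> x /=; rewrite /measurable_realfun.mindic indicE; case: (boolP (x \in ~` Z)); last first.
    by rewrite mulr0.
  rewrite inE mulr1 => nZ.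
  have [Dx|nD] := pselect (D x); first by rewrite FG.
  by rewrite FD//  -(GD _ nD).
Qed.

(** Indicators, then simple functions, then monotone limits. The density w of m is known on Borel
    subsets of B only, so the restriction to B is carried through each stage. *)
Lemma integral_weighted (m lam : {measure set T -> \bar R}) B (w : T -> R)
    (h : T -> \bar R) :
  measurable B -> measurable_fun B w -> (forall x, B x -> (0 <= w x)%R) ->
  (forall A, measurable A -> A `<=` B -> m A = \int[lam]_(x in A) (w x)%:E) ->
  measurable_fun B h -> (forall x, B x -> 0 <= h x) ->
  \int[m]_(x in B) h x = \int[lam]_(x in B) (h x * (w x)%:E).
Proof.
move=> mB mw w0 mE mh h0.
have mew : measurable_fun B (EFin \o w) by exact/measurable_EFinP.
have indic_case (y : R) A : (0 <= y)%R -> measurable A ->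
    \int[m]_(x in B) (y * \1_A x)%:E =
    \int[lam]_(x in B) ((y * \1_A x)%:E * (w x)%:E).
  move=> y0 mA.
  have mi : measurable_fun B (fun x => (\1_A x : R)%:E).
    by apply/measurable_EFinP; apply: measurable_funTS; exact: measurable_indic.
  under eq_integral do rewrite EFinM.
  rewrite ge0_integralZl//.
  rewrite integral_indic//.
  under [RHS]eq_integral do rewrite EFinM -muleA.
  rewrite ge0_integralZl//; last 2 first.
    - exact: emeasurable_funM.
    - by move=> x Bx; rewrite mule_ge0// lee_fin// w0.
  rewrite mE//; last exact: measurableI.
  congr (_ * _); rewrite setIC integral_mkcondr; apply: eq_integral => x _.
  by rewrite patchE indicE; case: ifP => _; rewrite ?mul1e ?mul0e.
have sfun_case (a : {nnsfun T >-> R}) :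
    \int[m]_(x in B) (a x)%:E = \int[lam]_(x in B) ((a x)%:E * (w x)%:E).
  have ai_ge0 x y : (0 <= y * \1_(a @^-1` [set y]) x)%R.
    by rewrite -lee_fin; exact: nnfun_muleindic_ge0.
  have mai y : measurable_fun B (fun x => (y * \1_(a @^-1` [set y]) x)%:E).
    apply/measurable_EFinP; apply: measurable_funTS; apply: measurable_funM => //.
  transitivity (\int[m]_(x in B)
      (\sum_(y \in range a) (y * \1_(a @^-1` [set y]) x)%:E)).
    by apply: eq_integral => x _; rewrite fsumEFin// -fimfunE.
  rewrite ge0_integral_fsum//; last by move=> y x _; rewrite lee_fin.
  transitivity (\int[lam]_(x in B)
      (\sum_(y \in range a) ((y * \1_(a @^-1` [set y]) x)%:E * (w x)%:E))); last first.
    apply: eq_integral => x _; rewrite -ge0_mule_fsuml; last first.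
      by move=> y; rewrite lee_fin.
    by rewrite fsumEFin// -fimfunE.
  rewrite ge0_integral_fsum//; last 2 first.
    - by move=> y; exact: emeasurable_funM.
    - by move=> y x Bx; rewrite mule_ge0// lee_fin// w0.
  apply: eq_fsbigr => y; rewrite inE => -[x _ <-].
  by apply: indic_case => //; exact: measurable_sfunP.
pose a := nnsfun_approx mB mh.
have ah x : B x -> (a n x)%:E @[n --> \oo] --> h x.
  by move=> Bx; apply: cvg_nnsfun_approx.
have anon x n k : (n <= k)%N -> (a n x <= a k x)%R.
  by move=> nk; exact/lefP/nd_nnsfun_approx.
transitivity (limn (fun n => \int[m]_(x in B) (a n x)%:E)).
  rewrite -monotone_convergence//.
  - by apply: eq_integral => x /[!inE] Bx; apply/esym/cvg_lim => //; exact: ah.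
  - by move=> n; apply/measurable_EFinP/measurable_funTS.
  - by move=> n x _; rewrite lee_fin.
  - by move=> x _ n k nk; rewrite lee_fin anon.
under eq_fun do rewrite sfun_case.
rewrite -monotone_convergence//.
- apply: eq_integral => x /[!inE] Bx; apply/cvg_lim => //.
  by apply: cvgeZr => //; exact: ah.
- by move=> n; apply: emeasurable_funM => //; apply/measurable_EFinP/measurable_funTS.
- by move=> n x Bx; rewrite mule_ge0// lee_fin// w0.
- by move=> x Bx n k nk; rewrite lee_wpmul2r ?lee_fin ?w0// anon.
Qed.

End RawIntegral.

Section Weighted.
Local Open Scope ereal_scope.
Context d (T : measurableType d) (R : realType).

(** Multiplication by the nonnegative w commutes with taking positive and negative parts, which
    reduces the claim to nonnegative integrands. *)
Lemma integral_weighted_signed (m lam : {measure set T -> \bar R}) B (w : T -> R)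
    (h : T -> \bar R) :
  measurable B -> measurable_fun B w -> (forall x, B x -> (0 <= w x)%R) ->
  (forall A, measurable A -> A `<=` B -> m A = \int[lam]_(x in A) (w x)%:E) ->
  measurable_fun B h ->
  \int[m]_(x in B) h x = \int[lam]_(x in B) (h x * (w x)%:E).
Proof.
move=> mB mw w0 mE mh; rewrite integralE [RHS]integralE.
rewrite (integral_weighted mB mw w0 mE); last 2 first.
  - exact: measurable_funepos.
  - by move=> x _; exact: funepos_ge0.
rewrite (integral_weighted mB mw w0 mE); last 2 first.
  - exact: measurable_funeneg.
  - by move=> x _; exact: funeneg_ge0.
congr (_ - _); apply: eq_integral => x /[!inE] Bx.
- by rewrite !funeposE maxe_pMl ?mul0e ?lee_fin ?w0.
- by rewrite !funenegE maxe_pMl ?mul0e ?lee_fin ?w0// mulNe.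
Qed.

Lemma measure_of_weight (lam : {measure set T -> \bar R}) D (w : T -> \bar R) :
  measurable D -> measurable_fun D w -> (forall x, D x -> 0 <= w x) ->
  exists m : {measure set T -> \bar R},
    forall A, m A = \int[lam]_(x in A `&` D) w x.
Proof.
move=> mD mw w0.
pose w' := w \_ D.
have mw' : measurable_fun setT w' by apply/(measurable_restrictT _ mD).
have w'0 x : 0 <= w' x.
  by rewrite /w' patchE; case: ifPn => // /[!inE]; exact: w0.
pose nu A := \int[lam]_(x in A) w' x.
have nu0 : nu set0 = 0 by rewrite /nu integral_set0.
have nuge0 A : 0 <= nu A by rewrite /nu integral_ge0.
have nuS : semi_sigma_additive nu by exact: semi_sigma_additive_nng_induced.
pose mix := isMeasure.Build _ T R nu nu0 nuge0 nuS.
pose mu : {measure set T -> \bar R} := HB.pack nu mix.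
by exists mu => A; rewrite /= /nu /w' -integral_mkcondr.
Qed.

End Weighted.

(** * Densities with respect to a finite measure *)

Section HasDensity.
Local Open Scope ereal_scope.
Context (R : realType) (N : nat).
Local Notation E := (borel_rV R N).
Implicit Types (K Z : set E) (lam : {finite_measure set E -> \bar R}).

(* Z is a null set on which f need not be defined. *)
Definition has_density K Z lam (f : E -> R) (mu : set E -> \bar R) :=
  lam.-integrable (K `\` Z) (EFin \o f) /\
  forall B, measurable B -> B `<=` K ->
    mu B = \int[lam]_(x in B `\` Z) (f x)%:E.

Variables (K Z : set E) (lam : {finite_measure set E -> \bar R}).
Hypotheses (mK : measurable K) (mZ : measurable Z).

Let mKZ : measurable (K `\` Z). Proof. exact: measurableD. Qed.

Lemma has_density_eq f g mu nu : has_density K Z lam f mu ->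
  (forall x, (K `\` Z) x -> f x = g x) ->
  (forall B, measurable B -> B `<=` K -> nu B = mu B) ->
  has_density K Z lam g nu.
Proof.
move=> [fi fE] fg munu; split.
  by apply: eq_integrable fi => // x /[!inE] xD /=; rewrite fg.
move=> B mB BK; rewrite munu// fE//; apply: eq_integral => x /[!inE] -[Bx nZ].
by rewrite fg//; split => //; exact: BK.
Qed.

Lemma has_density_uniq f mu nu B : has_density K Z lam f mu -> has_density K Z lam f nu ->
  measurable B -> B `<=` K -> mu B = nu B.
Proof. by move=> [_ E1] [_ E2] mB BK; rewrite E1// E2. Qed.

Lemma has_density_measurable f mu : has_density K Z lam f mu ->
  measurable_fun (K `\` Z) f.
Proof. by case=> /integrableP[/measurable_EFinP]. Qed.

Let sub_int B (f : E -> R) : measurable B -> B `<=` K ->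
  lam.-integrable (K `\` Z) (EFin \o f) -> lam.-integrable (B `\` Z) (EFin \o f).
Proof.
move=> mB BK; apply: integrableS => //; first exact: measurableD.
exact: setSD.
Qed.

Lemma has_density_fin f mu B : has_density K Z lam f mu ->
  measurable B -> B `<=` K -> mu B \is a fin_num.
Proof.
move=> [fi fE] mB BK; rewrite fE//; apply: integrable_fin_num.
  exact: measurableD.
exact: sub_int.
Qed.

Lemma has_densityN f mu : has_density K Z lam f mu ->
  has_density K Z lam (fun x => - f x)%R (fun A => - mu A).
Proof.
move=> [fi fE]; split; first exact: (integrableN fi).
move=> B mB BK; rewrite fE// -integralN//.
exact: (integrable_add_def (measurableD mB mZ) (sub_int mB BK fi)).
Qed.

Lemma has_density_pos f mu : has_density K Z lam f mu ->
  has_density K Z lam (fun x => Num.max (f x) 0)%R (pos_var mu).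
Proof.
move=> fd; have mf := has_density_measurable fd; case: fd => fi fE.
have pi : lam.-integrable (K `\` Z) (EFin \o (fun x => Num.max (f x) 0)%R).
  apply: le_integrable fi => //.
    by apply/measurable_EFinP; exact: measurable_maxr.
  move=> x _ /=; rewrite lee_fin; case: (leP (f x) 0%R) => _ //.
  by rewrite normr0.
split=> // B mB BK; rewrite /pos_var; apply/eqP; rewrite eq_le; apply/andP; split.
  apply: ge_ereal_sup => _ [A [mA AB] <-].
  have AK := subset_trans AB BK.
  rewrite fE//; apply: (@le_trans _ _ (\int[lam]_(x in A `\` Z) (Num.max (f x) 0)%:E)).
    apply: le_integral.
    - exact: measurableD.
    - exact: sub_int.
    - exact: sub_int.
    - by move=> x _ /=; rewrite lee_fin le_max lexx.
  apply: ge0_subset_integral.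
  - exact: measurableD.
  - exact: measurableD.
  - apply: measurable_int; exact: (sub_int mB BK pi).
  - by move=> x _; rewrite lee_fin le_max lexx orbT.
  - exact: setSD.
(* The Hahn set of the density: the supremum defining [pos_var] is attained at the part of B off Z
   where f is nonnegative. *)
pose B0 := (B `\` Z) `&` f @^-1` `[0%R, +oo[%classic.
have mB0 : measurable B0.
  have mfB : measurable_fun (B `\` Z) f.
    by apply: measurable_funS mf => //; exact: setSD.
  by apply: mfB => //; exact: measurableD.
have B0B : B0 `<=` B by move=> x [[]].
apply: ereal_sup_ubound; exists B0 => //.
rewrite fE//; last exact: subset_trans BK.
rewrite (_ : B0 `\` Z = B0); last first.
  by apply/seteqP; split=> x; [case|move=> B0x; split=> //; case: B0x => -[]].
rewrite integral_mkcondr; apply: eq_integral => x /[!inE] -[Bx nZ].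
rewrite patchE; case: ifPn => [|/negP].
  by rewrite inE/= in_itv/= andbT => fx; rewrite max_l.
by rewrite inE/= in_itv/= andbT => /negP; rewrite -ltNge => /ltW fx; rewrite max_r.
Qed.

Lemma has_density_neg f mu : has_density K Z lam f mu ->
  has_density K Z lam (fun x => Num.max (- f x) 0)%R (neg_var mu).
Proof. by move/has_densityN/has_density_pos. Qed.

(** A set function with nonnegative density agrees on the Borel subsets of K with a true measure m,
    so [raw_integral] turns the integral against it into one against m, and the weight f is then
    extracted. The bound on h provides integrability. *)
Lemma has_density_integral (f h : E -> R) mu (C : R) :
  has_density K Z lam f mu -> (forall x, (K `\` Z) x -> (0 <= f x)%R) ->
  measurable_fun (K `\` Z) h -> (forall x, (K `\` Z) x -> (`|h x| <= C)%R) ->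
  has_density K Z lam (fun x => h x * f x)%R (fun B => \int[mu]_(x in B) (h x)%:E).
Proof.
move=> fd f0 mh hC; have mf := has_density_measurable fd; case: fd => fi fE.
have [m mE] := @measure_of_weight _ E R lam (K `\` Z) (EFin \o f) mKZ
  (proj2 (measurable_EFinP _ _) mf) (fun x xD => f0 x xD).
split.
  apply: (@le_integrable _ _ _ lam _ mKZ _ (fun x => C%:E * (f x)%:E)); last first.
  - exact: integrableZl.
  - move=> x xD /=; rewrite lee_fin !normrM ler_wpM2r//.
    by rewrite (le_trans (hC _ xD))// ler_norm.
  - by apply/measurable_EFinP; exact: measurable_funM.
move=> B mB BK.
have BZK : B `\` Z `<=` K `\` Z by exact: setSD.
have mBZ : measurable (B `\` Z) by exact: measurableD.
rewrite (@raw_integral _ _ _ m _ B Z _ ((EFin \o h) \_ (B `\` Z)))//.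
- rewrite -integral_mkcondr setIDA setIid.
  rewrite (@integral_weighted_signed _ _ _ m lam _ f)//=.
  + exact: measurable_funS mf.
  + by move=> x xD; apply: f0; exact: BZK.
  + by move=> A mA AB; rewrite mE; congr (integral _ _ _); apply/setIidPl/(subset_trans AB).
  + by apply/measurable_EFinP; exact: measurable_funS mh.
- rewrite mE (_ : _ `&` _ = set0) ?integral_set0//.
  by apply/seteqP; split=> x //= -[] [] ? ? [].
- move=> A mA AB; rewrite fE//; last exact: subset_trans BK.
  rewrite mE; congr (integral _ _ _); apply/seteqP; split=> x /=.
    by move=> [Ax nZ]; split => //; split => //; apply/BK/AB.
  by move=> [Ax [_ nZ]]; split.
- by move=> x Bx nZ; rewrite patchE mem_set.
Qed.

(** [density] is defined through the Jordan decomposition of mu, whose two parts have as densities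
    the positive and negative parts of f; they recombine to f. *)
Lemma has_density_mul (f h : E -> R) mu (C : R) :
  has_density K Z lam f mu ->
  measurable_fun (K `\` Z) h -> (forall x, (K `\` Z) x -> (`|h x| <= C)%R) ->
  has_density K Z lam (fun x => h x * f x)%R (density h mu).
Proof.
move=> fd mh hC.
have [pi pE] := has_density_integral (has_density_pos fd) (fun x _ => ltac:(by rewrite le_max lexx orbT)) mh hC.
have [ni nE] := has_density_integral (has_density_neg fd) (fun x _ => ltac:(by rewrite le_max lexx orbT)) mh hC.
have key x : (h x * f x = h x * Num.max (f x) 0 - h x * Num.max (- f x) 0)%R.
  rewrite -mulrBr; congr (_ * _)%R.
  by case: (leP (f x) 0%R) => f0;
     [rewrite max_l ?oppr_ge0// sub0r opprK|rewrite max_r ?subr0// oppr_le0 ltW].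
split.
  under [X in _.-integrable _ X]eq_fun do rewrite /= key.
  exact: (integrableB mKZ pi ni).
move=> B mB BK; rewrite /density pE// nE//.
rewrite -integralB//; last 3 first.
- exact: measurableD.
- exact: sub_int.
- exact: sub_int.
by apply: eq_integral => x _; rewrite key.
Qed.

Lemma has_density_sum (I : Type) (r : seq I) (P : pred I) (f : I -> E -> R) mu :
  (forall i, P i -> has_density K Z lam (f i) (mu i)) ->
  has_density K Z lam (fun x => \sum_(i <- r | P i) f i x)%R
    (fun B => \sum_(i <- r | P i) mu i B).
Proof.
move=> H; elim: r => [|i r IH].
  apply: (@has_density_eq (cst 0%R) _ (fun=> 0)).
  - by split => [|B _ _]; [exact: integrable0|rewrite integral0].
  - by move=> x _; rewrite big_nil.
  - by move=> B _ _; rewrite big_nil.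
case: (boolP (P i)) => Pi; last first.
  apply: (has_density_eq IH) => *; rewrite big_cons (negbTE Pi)//.
have [fi fE] := H _ Pi; have [si sE] := IH.
split.
  under [X in _.-integrable _ X]eq_fun do rewrite /= big_cons Pi.
  exact: (integrableD mKZ fi si).
move=> B mB BK; rewrite big_cons Pi fE// sE//.
rewrite -integralD//; last 3 first.
- exact: measurableD.
- exact: sub_int.
- exact: sub_int.
by apply: eq_integral => x _; rewrite big_cons Pi.
Qed.

End HasDensity.

(** * Total variation *)

Section EuclideanNorm.
Context (R : realType) (I : finType).
Implicit Types (a b u f : I -> R).

(** Indexed by any finite type, so as to serve both for the components of a p-tensor and, through
    [x ord0], for [enorm]. *)
Definition l2norm a : R := Num.sqrt (\sum_(i : I) a i ^+ 2).

Lemma l2norm_ge0 a : 0 <= l2norm a.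
Proof. exact: sqrtr_ge0. Qed.

Lemma sqr_l2norm a : l2norm a ^+ 2 = \sum_(i : I) a i ^+ 2.
Proof. by rewrite sqr_sqrtr// sumr_ge0// => i _; exact: sqr_ge0. Qed.

Lemma l2norm_coord a i : `|a i| <= l2norm a.
Proof.
rewrite -ler_sqr ?nnegrE ?l2norm_ge0// sqr_l2norm real_normK ?num_real//.
by rewrite (bigD1 i)//= lerDl; apply: sumr_ge0 => j _; exact: sqr_ge0.
Qed.

Lemma l2norm_le_sum a : l2norm a <= \sum_(i : I) `|a i|.
Proof.
rewrite -ler_sqr ?nnegrE ?l2norm_ge0 ?sumr_ge0// sqr_l2norm.
rewrite expr2 mulr_suml; apply: ler_sum => i _.
rewrite -real_normK ?num_real// expr2 ler_wpM2l// (bigD1 i)//= lerDl.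
exact: sumr_ge0.
Qed.

Lemma l2norm_eq0 a : l2norm a = 0 -> forall i, a i = 0.
Proof.
move=> a0 i; apply/eqP; rewrite -normr_eq0 eq_le normr_ge0 andbT -a0.
exact: l2norm_coord.
Qed.

Lemma cauchy_schwarz a b : \sum_(i : I) a i * b i <= l2norm a * l2norm b.
Proof.
have [a0|a_neq0] := eqVneq (l2norm a) 0.
  by rewrite a0 mul0r big1// => i _; rewrite (l2norm_eq0 a0) mul0r.
have [b0|b_neq0] := eqVneq (l2norm b) 0.
  by rewrite b0 mulr0 big1// => i _; rewrite (l2norm_eq0 b0) mulr0.
have s0 : 0 < l2norm a by rewrite lt_def a_neq0 l2norm_ge0.
have t0 : 0 < l2norm b by rewrite lt_def b_neq0 l2norm_ge0.
set s := l2norm a in s0 a_neq0 *; set t := l2norm b in t0 b_neq0 *.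
have st0 : 0 < s * t by exact: mulr_gt0.
(* AM-GM: 2 (s t) (a b) <= t^2 a^2 + s^2 b^2 *)
have H i : 2 * (s * t) * (a i * b i) <= t ^+ 2 * a i ^+ 2 + s ^+ 2 * b i ^+ 2.
  rewrite -subr_ge0.
  rewrite (_ : _ - _ = (t * a i - s * b i) ^+ 2) ?sqr_ge0//.
  by ring.
have : \sum_(i : I) 2 * (s * t) * (a i * b i) <=
       \sum_(i : I) (t ^+ 2 * a i ^+ 2 + s ^+ 2 * b i ^+ 2).
  by apply: ler_sum => i _; exact: H.
rewrite -mulr_sumr big_split/= -!mulr_sumr -!sqr_l2norm -/s -/t.
rewrite (_ : t ^+ 2 * s ^+ 2 + s ^+ 2 * t ^+ 2 = 2 * (s * t) * (s * t)); last by ring.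
by rewrite ler_pM2l// mulr_gt0.
Qed.

Lemma l2norm_dual a : exists u, (forall i, `|u i| <= 1) /\ l2norm u <= 1 /\
  \sum_(i : I) u i * a i = l2norm a.
Proof.
have [a0|a_neq0] := eqVneq (l2norm a) 0.
  exists (fun=> 0); split; [|split].
  - by move=> i; rewrite normr0.
  - by rewrite /l2norm big1 ?sqrtr0// => i _; rewrite expr0n.
  - by rewrite a0 big1// => i _; rewrite mul0r.
have s0 : 0 < l2norm a by rewrite lt_def a_neq0 l2norm_ge0.
exists (fun i => a i / l2norm a); split; [|split].
- move=> i; rewrite normrM normfV (ger0_norm (l2norm_ge0 a)).
  by rewrite ler_pdivrMr// mul1r l2norm_coord.
- rewrite -(@ler_pXn2r _ 2)// ?nnegrE ?l2norm_ge0// expr1n sqr_l2norm.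
  under eq_bigr do rewrite exprMn.
  by rewrite -mulr_suml -sqr_l2norm exprVn divff// expf_eq0.
- under eq_bigr do rewrite mulrAC -expr2.
  by rewrite -mulr_suml -sqr_l2norm expr2 mulfK.
Qed.

(* a supporting functional of the norm at b almost supports it at nearby a *)
Lemma l2norm_near_dual b (e : R) : exists u, l2norm u <= 1 /\
  forall a, (forall i, `|a i - b i| <= e) ->
    l2norm a - 2 * (#|I|%:R * e) <= \sum_(i : I) u i * a i.
Proof.
have near_le u a c : (forall i, `|u i| <= 1) -> (forall i, `|a i - c i| <= e) ->
    \sum_(i : I) u i * a i <= \sum_(i : I) u i * c i + #|I|%:R * e.
  move=> u1 ac; rewrite -lerBlDl -sumrB.
  rewrite (_ : #|I|%:R * e = \sum_(i : I) e); last first.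
    by rewrite sumr_const mulr_natl.
  apply: ler_sum => i _; rewrite -mulrBr (le_trans (ler_norm _))// normrM.
  by rewrite (le_trans _ (ac i))// ler_piMl.
have [u [u1 [un ub]]] := l2norm_dual b.
(* With u dual to b, an error #|I| e is made twice: in replacing b by a under u, and in comparing
   the norm of a with that of b. *)
exists u; split => // a ab.
have ba i : `|b i - a i| <= e by rewrite distrC.
have [w [w1 [wn wa]]] := l2norm_dual a.
have H1 := near_le _ _ _ u1 ba.
have H2 := near_le _ _ _ w1 ab.
have H3 : \sum_(i : I) w i * b i <= l2norm b.
  by rewrite (le_trans (cauchy_schwarz _ _))// ler_piMl// l2norm_ge0.
rewrite ub in H1; rewrite wa in H2.
lra.
Qed.

End EuclideanNorm.

Section TotalVariation.
Local Open Scope ereal_scope.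
Context (R : realType) (N : nat).
Local Notation E := (borel_rV R N).
Variables (K Z : set E) (lam : {finite_measure set E -> \bar R}).
Hypotheses (mK : measurable K) (mZ : measurable Z).
Variables (I : finType) (Omega : set 'rV[R]_N).
Hypothesis KOmega : forall B : set E, B `<=` K -> compactly_contained B Omega.
Variables (f : I -> E -> R) (m : I -> set E -> \bar R).
Hypothesis fm : forall i, has_density K Z lam (f i) (m i).

Let mKZ : measurable (K `\` Z). Proof. exact: measurableD. Qed.
Let g x := l2norm (fun i => f i x).

Let mf i : measurable_fun (K `\` Z) (f i).
Proof. exact: has_density_measurable (fm i). Qed.

Lemma has_density_lincomb (a : I -> R) :
  has_density K Z lam (fun x => \sum_(i : I) a i * f i x)%R
    (fun B => \sum_(i : I) (a i)%:E * m i B).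
Proof.
apply: has_density_sum => // i _.
have [fi fE] := fm i; split; first exact: (integrableZl mKZ _ fi).
move=> B mB BK; rewrite fE//.
under [RHS]eq_integral do rewrite EFinM.
rewrite integralZl//; first exact: measurableD.
apply: integrableS fi => //; first exact: measurableD.
exact: setSD.
Qed.

Let mg : measurable_fun (K `\` Z) g.
Proof.
apply: (@measurableT_comp _ _ _ _ _ _ (@Num.sqrt R)).
  by apply: continuous_measurable_fun; exact: sqrt_continuous.
apply: measurable_sum => i; exact: measurable_funX.
Qed.

Let gi : lam.-integrable (K `\` Z) (EFin \o g).
Proof.
apply: (@le_integrable _ _ _ lam _ mKZ _ (fun x => \sum_(i : I) `|(f i x)%:E|)).
- exact/measurable_EFinP.
- move=> x _ /=; rewrite sumEFin lee_fin (ger0_norm (l2norm_ge0 _)).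
  by rewrite ger0_norm ?sumr_ge0//; exact: l2norm_le_sum.
- apply: integrable_sum => // i _; apply: integrable_abse.
  by case: (fm i).
Qed.

Let gS B : measurable B -> B `<=` K -> lam.-integrable (B `\` Z) (EFin \o g).
Proof.
move=> mB BK; apply: integrableS gi => //; first exact: measurableD.
exact: setSD.
Qed.

(** Pair the vector a = m(B) with itself: |a|^2 is the integral of the scalar product of a and f,
    which Cauchy-Schwarz bounds by |a| times the integral of g. *)
Let cell_le B : measurable B -> B `<=` K ->
  (l2norm (fun i => fine (m i B)))%:E <= \int[lam]_(x in B `\` Z) (g x)%:E.
Proof.
move=> mB BK; set a := (fun i => fine (m i B)).
have g0 : 0 <= \int[lam]_(x in B `\` Z) (g x)%:E.
  by apply: integral_ge0 => x _; rewrite lee_fin l2norm_ge0.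
have [->//|s_neq0] := eqVneq (l2norm a) 0%R.
have s0 : (0 < l2norm a)%R by rewrite lt_def s_neq0 l2norm_ge0.
rewrite -(@lee_pmul2l _ (l2norm a)%:E)//.
rewrite -EFinM -expr2 sqr_l2norm.
rewrite (_ : (\sum_i a i ^+ 2)%:E = \sum_(i : I) (a i)%:E * m i B); last first.
  rewrite -sumEFin; apply: eq_bigr => i _.
  by rewrite expr2 EFinM {2}/a fineK// (has_density_fin mK mZ (fm i)).
have [li lE] := has_density_lincomb a.
rewrite lE// -integralZl//; last 2 first.
- exact: measurableD.
- exact: gS.
apply: le_integral.
- exact: measurableD.
- apply: integrableS li => //; first exact: measurableD.
  exact: setSD.
- by apply: integrableZl; [exact: measurableD|exact: gS].
- by move=> x _ /=; rewrite -EFinM lee_fin; exact: cauchy_schwarz.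
Qed.

(** Extended by 0, the densities are measurable on the whole space, so the grid cells are Borel sets
    without reference to K and Z. *)
Let f0 i : E -> R := (f i) \_ (K `\` Z).

Let mf0 i : measurable_fun setT (f0 i).
Proof. exact/(measurable_restrictT _ mKZ). Qed.

(* code of the cell of the e-grid that contains the vector (f i x)_i *)
Let key (e : R) (x : E) : nat :=
  pickle [ffun i => Num.floor (f0 i x / e)].

Let mkey (e : R) (h : nat) : (0 < e)%R -> measurable (key e @^-1` [set h]).
Proof.
move=> e0; have [[x0 x0h]|nx] := pselect (exists x0, key e x0 = h); last first.
  rewrite (_ : _ @^-1` _ = set0); first exact: measurable0.
  by apply/seteqP; split => // x xh; apply: nx; exists x.
(* A cell is a finite intersection of preimages of half-open intervals of length e, located by the
   sample point x0. *)
rewrite (_ : _ @^-1` _ = \bigcap_(i in [set: I])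
    (f0 i @^-1` `[(e * (Num.floor (f0 i x0 / e))%:~R)%R,
                  (e * (Num.floor (f0 i x0 / e) + 1)%:~R)%R[%classic)); last first.
  apply/seteqP; split => x /=.
    rewrite -x0h => /(pcan_inj pickleK) /ffunP H i _ /=.
    have := H i; rewrite !ffunE => <-.
    have /andP[h1 h2] := floor_itv (f0 i x / e)%R.
    by rewrite in_itv/= mulrC -ler_pdivlMr// h1/= mulrC -ltr_pdivrMr.
  move=> H; rewrite -x0h; congr pickle; apply/ffunP => i; rewrite !ffunE.
  have := H i Logic.I; rewrite /= in_itv/= => /andP[h1 h2]; apply: floor_def.
  by rewrite ler_pdivlMr// mulrC h1/= ltr_pdivrMr// mulrC.
apply: fin_bigcap_measurable => // i _.
by rewrite -[X in measurable X]setTI; exact: mf0.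
Qed.

Let key_near (e : R) x y i : (0 < e)%R -> key e x = key e y ->
  (`|f0 i x - f0 i y| <= e)%R.
Proof.
move=> e0 /(pcan_inj pickleK) /ffunP /(_ i); rewrite !ffunE => H.
have /andP[] := floor_itv (f0 i x / e)%R; rewrite H ler_pdivlMr// ltr_pdivrMr// => h1 h2.
have /andP[] := floor_itv (f0 i y / e)%R; rewrite ler_pdivlMr// ltr_pdivrMr// => h3 h4.
move: h1 h2 h3 h4; rewrite intrD mulrDl mul1r => h1 h2 h3 h4.
by rewrite ler_norml; lra.
Qed.

(** On a cell the vector f moves by at most e in each coordinate, so a single u of norm at most 1
    nearly supports it at every point. Integrating the scalar product with u gives the pairing of u
    with m(P), at most the norm of m(P). *)
Let cell_ge (e : R) B h : (0 < e)%R -> measurable B -> B `<=` K ->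
  forall P, P = B `&` key e @^-1` [set h] ->
  \int[lam]_(x in P `\` Z) (g x)%:E <=
    (l2norm (fun i => fine (m i P)))%:E + (2 * (#|I|%:R * e))%:E * lam (P `\` Z).
Proof.
move=> e0 mB BK _ ->; set P := B `&` _; set del := (2 * (#|I|%:R * e))%R.
have mP : measurable P by apply: measurableI => //; exact: mkey.
have mPZ : measurable (P `\` Z) by exact: measurableD.
have PK : P `<=` K by move=> x [/BK].
have del0 : (0 <= del)%R by rewrite /del; do !apply: mulr_ge0 => //; exact: ltW.
have [[x0 [Px0 nZ0]]|/nonemptyPn P0] := pselect ((P `\` Z) !=set0); last first.
  by rewrite P0 integral_set0 measure0 mule0 adde0 lee_fin l2norm_ge0.
have [u [u1 uP]] := l2norm_near_dual (fun i => f i x0) e.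
have fP x : (P `\` Z) x -> (g x - del <= \sum_(i : I) u i * f i x)%R.
  move=> [Px nZx]; apply: uP => i.
  have -> : f i x = f0 i x by rewrite /f0 patchE mem_set//; split => //; exact: PK.
  have -> : f i x0 = f0 i x0 by rewrite /f0 patchE mem_set//; split => //; exact: PK.
  by apply: key_near => //; rewrite (proj2 Px) (proj2 Px0).
have [li lE] := has_density_lincomb u.
have lfin : lam (P `\` Z) \is a fin_num by exact: fin_num_measure.
have ldel : lam.-integrable (P `\` Z) (fun=> del%:E).
  exact: finite_measure_integrable_cst.
rewrite -leeBlDr//; last by rewrite fin_numM.
rewrite -(integral_cst lam mPZ) -integralB//; last exact: gS.
apply: (@le_trans _ _ (\int[lam]_(x in P `\` Z) (\sum_(i : I) u i * f i x)%:E)).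
  apply: le_integral => //.
  - by apply: integrableB => //; exact: gS.
  - by apply: integrableS li => //; exact: setSD.
  - by move=> x /[!inE] xP /=; rewrite -EFinB lee_fin; exact: fP.
rewrite -lE// (_ : \sum_i _ = (\sum_i u i * fine (m i P))%:E); last first.
  rewrite -sumEFin; apply: eq_bigr => i _.
  by rewrite EFinM fineK// (has_density_fin mK mZ (fm i)).
by rewrite lee_fin (le_trans (cauchy_schwarz _ _))// ler_piMl// l2norm_ge0.
Qed.

(** For any admissible partition [cell_le] bounds each term, and the bounds add up to the integral
    over B. *)
Let tv_le B : measurable B -> B `<=` K ->
  Defs.total_variation Omega m B <= \int[lam]_(x in B `\` Z) (g x)%:E.
Proof.
move=> mB BK; apply: ge_ereal_sup => _ [P [mP _ tP UP] <-].
have BO : B `<=` Omega.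
  move=> x Bx; have [_] := KOmega BK; apply; exact: subset_closure.
have PB h : P h `<=` B.
  by move=> x Px; have : (B `&` Omega) x by [rewrite -UP; exists h]; case.
apply: (@le_trans _ _ (\sum_(h <oo) \int[lam]_(x in P h `\` Z) (g x)%:E)).
  apply: lee_nneseries => h _; first by rewrite lee_fin sqrtr_ge0.
  by apply: cell_le => //; exact: subset_trans BK.
rewrite -ge0_integral_bigcup//=.
- by rewrite -setD_bigcupl UP (setIidl BO).
- by move=> h; exact: measurableD.
- apply: measurable_int; rewrite -setD_bigcupl UP (setIidl BO); exact: gS.
- by move=> x _; rewrite lee_fin l2norm_ge0.
- apply/trivIsetP => i j _ _ ij; apply/seteqP; split=> // x [[Pi _] [Pj _]].
  by move/trivIsetP : tP => /(_ i j Logic.I Logic.I ij) <-.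
Qed.

(** The grid cells of f form an admissible partition on which [cell_ge] loses only a small multiple
    of the lam-mass, and lam is finite. *)
Let tv_ge B : measurable B -> B `<=` K ->
  \int[lam]_(x in B `\` Z) (g x)%:E <= Defs.total_variation Omega m B.
Proof.
move=> mB BK; apply/lee_addgt0Pr => e e0.
have BO : B `<=` Omega.
  move=> x Bx; have [_] := KOmega BK; apply; exact: subset_closure.
have mBZ : measurable (B `\` Z) by exact: measurableD.
(* The total loss will be c eps; dividing e by c + 1 makes it at most e and also covers c = 0. *)
pose c := (2 * #|I|%:R * fine (lam (B `\` Z)))%R.
have c0 : (0 <= c)%R by rewrite /c !mulr_ge0// fine_ge0.
pose eps := (e / (c + 1))%R.
have eps0 : (0 < eps)%R by rewrite divr_gt0// ltr_wpDl.
pose P (h : nat) : set E := B `&` key eps @^-1` [set h].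
have mP h : measurable (P h) by apply: measurableI => //; exact: mkey.
have UP : \bigcup_h P h = B.
  apply/seteqP; split => x; first by move=> [h _ []].
  by move=> Bx; exists (key eps x).
have tP : trivIset setT P.
  by apply/trivIsetP => i j _ _ /eqP ij; apply/seteqP; split=> // x [[_ /= xi] [_ /= xj]]; apply: ij; rewrite -xi -xj.
have tPZ : trivIset setT (fun h => P h `\` Z).
  apply/trivIsetP => i j _ _ ij; apply/seteqP; split=> // x [[Pi _] [Pj _]].
  by move/trivIsetP : tP => /(_ i j Logic.I Logic.I ij) <-.
have mPZ h : measurable (P h `\` Z) by exact: measurableD.
have UPZ : \bigcup_h (P h `\` Z) = B `\` Z by rewrite -setD_bigcupl UP.
pose del := (2 * (#|I|%:R * eps))%R.
have del0 : (0 <= del)%R by rewrite mulr_ge0// mulr_ge0// ltW.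
rewrite -[in leLHS]UPZ ge0_integral_bigcup//=; last 2 first.
- by rewrite UPZ; apply: measurable_int; exact: gS.
- by move=> x _; rewrite lee_fin l2norm_ge0.
apply: (@le_trans _ _ (\sum_(h <oo)
   ((l2norm (fun i => fine (m i (P h))))%:E + del%:E * lam (P h `\` Z)))).
  apply: lee_nneseries => h _.
    by move=> _; apply: integral_ge0 => x _; rewrite lee_fin l2norm_ge0.
  exact: (@cell_ge eps B h eps0 mB BK (P h) erefl).
rewrite nneseriesD; last 2 first.
- by move=> h _ _; rewrite lee_fin l2norm_ge0.
- by move=> h _ _; rewrite mule_ge0// lee_fin.
apply: leeD.
  apply: ereal_sup_ubound; exists P => //; split => //.
  - by move=> h; apply: KOmega => x [/BK].
  - by rewrite UP (setIidl BO).
rewrite nneseriesZl//.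
have -> : \sum_(h <oo) lam (P h `\` Z) = lam (B `\` Z).
  by rewrite -UPZ measure_bigcup//=; apply: eq_eseriesl => i; rewrite in_setT.
rewrite -(@fineK _ (lam (B `\` Z))); last exact: fin_num_measure.
rewrite -EFinM lee_fin (_ : _ * _ = c * eps)%R; last by rewrite /del /c; ring.
by rewrite /eps mulrA ler_pdivrMr ?ltr_wpDl// mulrC ler_pM2l// lerDl.
Qed.

Lemma has_density_total_variation :
  has_density K Z lam (fun x => l2norm (fun i => f i x)) (Defs.total_variation Omega m).
Proof.
split=> // B mB BK; apply/eqP; rewrite eq_le.
by rewrite tv_le// tv_ge.
Qed.

Lemma l2norm_le_total_variation B : measurable B -> B `<=` K ->
  (l2norm (fun i => fine (m i B)))%:E <= Defs.total_variation Omega m B.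
Proof. by move=> mB BK; rewrite (le_trans (cell_le mB BK))// tv_ge. Qed.

End TotalVariation.

(** * Push-forward and Radon-Nikodym densities *)

Section Push.
Local Open Scope ereal_scope.

(** Here f is arbitrary: both sides are suprema over simple functions, compared by [raw_integral]
    with the complement of D as the exceptional set. *)
Lemma integral_mrestr d (T : measurableType d) (R : realType)
    (mu : {measure set T -> \bar R}) (D : set T) (mD : measurable D) A (f : T -> \bar R) :
  measurable A -> \int[mrestr mu mD]_(x in A) f x = \int[mu]_(x in A `&` D) f x.
Proof.
move=> mA; have mAD : measurable (A `&` D) by exact: measurableI.
rewrite (@raw_integral _ _ _ (mrestr mu mD) _ A (~` D) _ (f \_ D))//.
- rewrite -integral_mkcondr.
  apply: (@raw_integral _ _ _ mu _ _ set0) => //; first by rewrite setI0.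
  by move=> B mB BD; rewrite /mrestr; congr (mu _); apply/setIidPl => x /BD[].
- exact: measurableC.
- by rewrite /= /mrestr -setIA setICl setI0 measure0.
- by move=> x Ax /contrapT Dx; rewrite patchE mem_set.
Qed.

Lemma finite_measure_pack d (T : measurableType d) (R : realType)
    (m : {measure set T -> \bar R}) : fin_num_fun m ->
  exists m' : {finite_measure set T -> \bar R}, forall A, m' A = m A.
Proof.
move=> fm.
have mT : m setT < +oo by rewrite ltey_eq fm.
by exists (mfrestr measurableT mT) => A; rewrite /= /mfrestr /mrestr setIT.
Qed.

Lemma measurable_extension d1 d2 (T1 : measurableType d1) (T2 : measurableType d2)
    (D : set T1) (g : T1 -> T2) : measurable D -> measurable_fun D g ->
  measurable_fun setT (fun y => if y \in D then g y else point).
Proof.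
move=> mD mg.
have preT : (fun y => y \in D) @^-1` [set true] = D.
  by apply/seteqP; split=> y /=; [move/set_mem|move/mem_set].
apply: measurable_fun_if => //.
- by apply: (measurable_fun_bool true); rewrite setTI preT.
- by rewrite setTI preT.
Qed.

(** lam' is the image under G of lam restricted to D'. Off D' the map is extended by the constant
    [point], where the restricted measure has no mass. *)
Lemma push_measure d (T : measurableType d) (R : realType)
    (lam : {finite_measure set T -> \bar R}) (D' D : set T) (G : T -> T) :
  measurable D' -> measurable_fun D' G ->
  (forall y, D' y -> D (G y)) -> measurable D ->
  exists lam' : {finite_measure set T -> \bar R},
    forall f : T -> \bar R, measurable_fun D f ->
      lam.-integrable D' (f \o G) ->
      lam'.-integrable D f /\
      forall A, measurable A -> A `<=` D ->
        \int[lam']_(x in A) f x = \int[lam]_(y in D' `&` G @^-1` A) f (G y).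
Proof.
move=> mD' mG GD mD.
pose G0 : T -> T := fun y => if y \in D' then G y else point.
have mG0 : measurable_fun setT G0 := measurable_extension mD' mG.
have mG0D A : measurable A -> measurable (G0 @^-1` A).
  by move=> mA; rewrite -[X in measurable X]setTI; exact: mG0.
pose nu_ : {measure set T -> \bar R} := pushforward (mrestr lam mD') G0.
pose nu := nu_ mG0.
have [lam' lamE] : exists m' : {finite_measure set T -> \bar R}, forall A, m' A = nu A.
  apply: finite_measure_pack => A mA; rewrite /nu /= /pushforward /mrestr.
  apply: fin_num_measure; apply: measurableI => //.
  exact: mG0D.
exists lam' => f mf fi.
pose h := f \_ D.
have mh : measurable_fun setT h by apply/(measurable_restrictT _ mD).
have G0D A : A `<=` D -> (G0 @^-1` A) `&` D' = D' `&` (G @^-1` A).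
  by move=> AD; apply/seteqP; split=> y /=; rewrite /G0 => -[];
     [move=> + Dy; rewrite mem_set|move=> Dy; rewrite mem_set].
have hG y : D' y -> h (G0 y) = f (G y).
  by move=> Dy; rewrite /G0 mem_set// /h patchE mem_set//; exact: GD.
have D'G : D' `&` G @^-1` D = D' by apply/setIidPl => y /GD.
have hi : (mrestr lam mD').-integrable (G0 @^-1` D) (h \o G0).
  apply/integrableP; split.
    by apply: measurable_funTS; exact: measurableT_comp.
  rewrite integral_mrestr; last exact: mG0D.
  move/integrableP: fi => [_]; apply: le_lt_trans.
  rewrite G0D// D'G le_eqVlt; apply/orP; left; apply/eqP.
  by apply: eq_integral => y /[!inE] Dy /=; rewrite hG.
split.
  apply: (@eq_integrable _ _ _ _ _ mD h).
    by move=> x /= xD; rewrite /h patchE xD.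
  have := integrable_pushforward mG0 mh hi mD.
  by move=> /integrableP[m1 m2]; apply/integrableP; split => //;
    rewrite (_ : \int[lam']_(x in D) `|h x| = \int[nu]_(x in D) `|h x|)//;
    apply: eq_measure_integral => A _ _; exact: lamE.
move=> A mA AD.
transitivity (\int[nu]_(x in A) h x).
  rewrite (_ : \int[nu]_(x in A) h x = \int[lam']_(x in A) h x); last first.
    by apply: eq_measure_integral => B _ _; rewrite [RHS]lamE.
  apply: eq_integral => x /[!inE] Ax.
  by rewrite /h patchE mem_set//; exact: AD.
rewrite /nu (integral_pushforward mG0 mh _ mA); last first.
  apply: integrableS hi; [exact: mG0D|exact: mG0D|].
  by move=> y; exact: AD.
rewrite integral_mrestr; last exact: mG0D.
rewrite G0D//; apply: eq_integral => y /[!inE] -[Dy _] /=.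
by rewrite hG.
Qed.

Section HasDensityPush.
Context (R : realType) (N : nat).
Local Notation E := (borel_rV R N).
Variables (K Z K' Z' : set E) (F G : E -> E) (V : set E).
Variables (lam : {finite_measure set E -> \bar R}).
Hypotheses (mK : measurable K) (mZ : measurable Z) (mK' : measurable K')
  (mZ' : measurable Z') (mG : measurable_fun K' G) (mF : measurable_fun K F).
Hypotheses (K'V : K' `<=` V) (GK : forall y, V y -> K (G y) -> K' y)
  (GK' : forall y, K' y -> K (G y)) (FG : forall y, K' y -> F (G y) = y)
  (FK : forall x, K x -> K' (F x) /\ G (F x) = x)
  (ZZ : forall y, K' y -> Z (G y) <-> Z' y).

(** F and G are inverse to each other between K and K', so f on K' becomes f o F on K. The measure
    lam' is chosen before f and mu: all tensor components must keep a common reference measure after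
    transport. *)
Lemma has_density_push : exists lam' : {finite_measure set E -> \bar R},
  forall f mu, has_density K' Z' lam f mu ->
    has_density K Z lam' (f \o F) (push V G mu).
Proof.
have mD' : measurable (K' `\` Z') by exact: measurableD.
have mD : measurable (K `\` Z) by exact: measurableD.
have GD y : (K' `\` Z') y -> (K `\` Z) (G y).
  by move=> [Ky nZ]; split; [exact: GK'|rewrite ZZ].
have FD x : (K `\` Z) x -> (K' `\` Z') (F x).
  by move=> [Kx nZ]; have [KF GF] := FK Kx; split => //; rewrite -ZZ// GF.
have [lam' H] := push_measure lam mD'
  (measurable_funS mK' (@subDsetl _ _ _) mG) GD mD.
exists lam' => f mu fd; have mf := has_density_measurable fd; case: fd => fi fE.
have mfF : measurable_fun (K `\` Z) (f \o F).
  apply: (measurable_comp mD' _ mf) => [_ [x xD <-]|]; first exact: FD.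
  by apply: measurable_funS mF => //; exact: subDsetl.
have fFG : lam.-integrable (K' `\` Z') ((EFin \o (f \o F)) \o G).
  by apply: eq_integrable fi => // y /[!inE] -[Ky _] /=; rewrite FG.
have [H1 H2] := H (EFin \o (f \o F)) (proj2 (measurable_EFinP _ _) mfF) fFG.
split => // B mB BK.
have mBZ : measurable (B `\` Z) by exact: measurableD.
(* For B inside K the push-forward from all of V sees only points of K'. *)
have VG : V `&` G @^-1` B = K' `&` G @^-1` B.
  by apply/seteqP; split=> y /= [h1 h2]; split => //; [exact/GK/BK|exact: K'V].
rewrite H2//; last exact: setSD.
rewrite /push VG fE; last 2 first.
- exact: mG.
- by move=> y [].
rewrite (_ : (K' `&` _) `\` Z' = (K' `\` Z') `&` G @^-1` (B `\` Z)).
  by apply: eq_integral => y /[!inE] -[[Ky _] _] /=; rewrite FG.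
apply/seteqP; split=> y /=.
  by move=> [[Ky By] nZ]; split=> //; split=> //; rewrite ZZ.
by move=> [[Ky nZ] [By _]].
Qed.

End HasDensityPush.

End Push.

Section RadonNikodym.
Local Open Scope ereal_scope.
Context (R : realType) (N : nat).
Local Notation E := (borel_rV R N).

(** The sum of the variations of the charges dominates each of them. A common reference measure is
    what allows Euclidean norms of several densities to be taken pointwise. *)
Lemma charges_dominated (I : eqType) (r : seq I) (nu : I -> {charge set E -> \bar R}) :
  exists lam : {finite_measure set E -> \bar R},
    forall i, i \in r -> nu i `<< lam.
Proof.
elim: r => [|i r [lam IH]].
  have [lam _] := @finite_measure_pack _ _ _ (mzero : {measure set E -> \bar R})
    (fun _ _ => erefl).
  by exists lam.
have [P [Q PQ]] := Hahn_decomposition (nu i).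
have [lam' lamE] := @finite_measure_pack _ _ _
    (measure_add lam (charge_variation PQ) : {measure set E -> \bar R})
    (fun A mA => ltac:(by rewrite /= /measure_add /msum !big_ord_recl big_ord0/=
       fin_numD addr0 !fin_num_measure)).
exists lam' => j; rewrite inE => jr; apply/null_content_dominatesP => A mA.
move=> lA0.
have /eqP : lam A + charge_variation PQ A = 0.
  by rewrite -measure_addE; exact: etrans (esym (lamE A)) lA0.
rewrite padde_eq0// => /andP[/eqP lA /eqP vA].
case/predU1P : jr => [->|jr].
  apply/eqP; rewrite -abse_eq0 eq_le abse_ge0 andbT -vA.
  exact: abse_charge_variation.
by have /null_content_dominatesP := IH j jr; apply.
Qed.

(** The Radon-Nikodym derivatives are finite, hence real functions through [fine]. Since [m i]
    vanishes on Borel subsets of Z inside K, the integral may be restricted to the complement of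
    Z. *)
Lemma has_density_Radon_Nikodym (I : finType) (K Z : set E) (m : I -> set E -> \bar R) :
  measurable K -> measurable Z ->
  (forall i, exists nu : {charge set E -> \bar R},
     forall B, measurable B -> B `<=` K -> m i B = nu B) ->
  (forall i B, measurable B -> B `<=` K -> B `<=` Z -> m i B = 0) ->
  exists lam f, forall i, has_density K Z lam (f i) (m i).
Proof.
move=> mK mZ /choice[nu nuE] m0.
have [lam lamP] := charges_dominated (enum I) nu.
exists lam, (fun i => fine \o (Radon_Nikodym (nu i) lam)) => i.
have nl : nu i `<< lam by apply: lamP; rewrite mem_enum.
have fE x : (fine (Radon_Nikodym (nu i) lam x))%:E = Radon_Nikodym (nu i) lam x.
  by rewrite fineK//; exact: Radon_Nikodym_fin_num.
split.
  have mKZ : measurable (K `\` Z) by exact: measurableD.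
  apply: (@eq_integrable _ _ _ _ _ mKZ (Radon_Nikodym (nu i) lam)).
    by move=> x _ /=; rewrite fE.
  apply: (@integrableS _ _ _ _ setT) => //.
  exact: Radon_Nikodym_integrable.
move=> B mB BK.
have mBZ : measurable (B `\` Z) by exact: measurableD.
have mBIZ : measurable (B `&` Z) by exact: measurableI.
under eq_integral do rewrite /= fE.
rewrite -Radon_Nikodym_integral// nuE// (chargeDI (nu i) mB mZ).
rewrite -(nuE i (B `&` Z))//; last by move=> x [/BK].
rewrite m0//; last by move=> x [/BK].
by rewrite adde0.
Qed.

End RadonNikodym.

Lemma measure_bigcup_nat d (T : measurableType d) (R : realType)
    (M : {measure set T -> \bar R}) (F : nat -> set T) :
  (forall n, measurable (F n)) -> trivIset setT F ->
  M (\bigcup_n F n) = (\sum_(n <oo) M (F n))%E.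
Proof.
move=> mF tF; rewrite measure_bigcup//.
by apply: eq_eseriesl => i; rewrite in_setT.
Qed.

(** * Borel sets and compact exhaustions of open sets *)

Section BorelSets.
Context (R : realType) (N : nat).
Local Notation E := (borel_rV R N).

Lemma open_borel (T : ptopologicalType) (A : set (borel T)) :
  open (A : set T) -> measurable A.
Proof. by move=> oA; apply: sub_sigma_algebra. Qed.

Lemma closed_borel (T : ptopologicalType) (A : set (borel T)) :
  closed (A : set T) -> measurable A.
Proof.
move=> cA; rewrite -(setCK A); apply: measurableC; apply: open_borel.
by rewrite openC.
Qed.

Lemma compact_borel (A : set E) : compact (A : set 'rV[R]_N) -> measurable A.
Proof.
by move=> cA; apply: closed_borel; apply: compact_closed cA; exact: norm_hausdorff.
Qed.

Lemma sub_compactly_contained (K Omega : set 'rV[R]_N) :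
  compact K -> K `<=` Omega -> forall B, B `<=` K -> compactly_contained B Omega.
Proof.
move=> cK KO B BK.
have clK : closed K by apply: compact_closed cK; exact: norm_hausdorff.
have BcK : closure B `<=` K by rewrite (closure_id K).1//; exact: closureS.
split; last exact: subset_trans KO.
by apply: (subclosed_compact _ cK) => //; exact: closed_closure.
Qed.

Lemma compact_exhaustion (Omega : set 'rV[R]_N) : open Omega ->
  exists K : nat -> set E,
    [/\ forall n, compact (K n : set 'rV[R]_N), forall n, K n `<=` Omega,
        forall n m, (n <= m)%N -> K n `<=` K m & \bigcup_n K n = Omega].
Proof.
move=> oO.
pose K n := [set x : 'rV[R]_N | `|x| <= n%:R] `&`
            [set x | ball x n.+1%:R^-1 `<=` Omega].
have KO n : K n `<=` Omega by move=> x [_]; apply; exact: ballxx.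
exists K; split => //.
- move=> n; apply: bounded_closed_compact.
    exists n%:R; split; first exact: num_real.
    by move=> M nM x [/= xn _]; rewrite (le_trans xn)// ltW.
  apply: closedI.
    have -> : [set x : 'rV[R]_N | `|x| <= n%:R] = Num.norm @^-1` [set r : R | r <= n%:R] by [].
    by apply: closed_comp => [x _|]; [exact: norm_continuous|exact: closed_le].
  (* If a point y outside Omega lies in the ball around x, it lies in the ball of the same radius
     around every z near x; so the complement is open. *)
  rewrite -(setCK [set _ | _]); apply: open_closedC.
  rewrite openE => x /= /existsNP[y /not_implyP[xy nOy]].
  have yx : nbhs x (ball y n.+1%:R^-1) by apply: open_nbhs_nbhs; split; [exact: ball_open|exact/ball_sym].
  by apply: filterS yx => z yz /= zO; apply: nOy; apply: zO; exact/ball_sym.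
- move=> n m nm x [/= xn xO]; split => /=.
    by rewrite (le_trans xn)// ler_nat.
  apply: subset_trans xO; apply: le_ball.
  by rewrite lef_pV2 ?posrE// ler_nat.
- apply/seteqP; split=> x; first by move=> [n _]; exact: KO.
  move=> Ox; have /nbhs_ballP[e /= e0 eO] : nbhs x Omega by exact: open_nbhs_nbhs.
  pose n := maxn (Num.truncn `|x|).+1 (Num.truncn e^-1).+1.
  exists n => //; split => /=.
    rewrite ltW// (lt_le_trans (truncnS_gt _))// ler_nat leq_maxl//.
  apply: subset_trans eO; apply: le_ball.
  rewrite invf_ple ?posrE// ltW// (lt_le_trans (truncnS_gt _))// ler_nat.
  by rewrite leqW// leq_maxr.
Qed.

End BorelSets.

(** * The total variation as a Borel measure *)

Section GlobalMeasure.
Local Open Scope ereal_scope.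
Context (R : realType) (N : nat).
Local Notation E := (borel_rV R N).

Lemma has_density_measure (K Z : set E) lam f mu : measurable K -> measurable Z ->
  has_density K Z lam f mu -> (forall x, (K `\` Z) x -> (0 <= f x)%R) ->
  exists m : {measure set E -> \bar R},
    forall A, measurable A -> m A = mu (A `&` K).
Proof.
move=> mK mZ fd f0; have mf := has_density_measurable fd; case: fd => fi fE.
have mKZ : measurable (K `\` Z) by exact: measurableD.
have [m mE] := @measure_of_weight _ E R lam (K `\` Z) (EFin \o f) mKZ
  (proj2 (measurable_EFinP _ _) mf) (fun x xD => f0 x xD).
by exists m => A mA; rewrite mE fE ?setIDA//; exact: measurableI.
Qed.

Section TotalVariationMeasure.
Variables (I : finType) (Omega : set 'rV[R]_N) (m : I -> set E -> \bar R).
Hypothesis oOmega : open Omega.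
(** The exceptional set, the reference measure and the densities may change with K; only the set
    functions [m i] are common to all compacts. *)
Hypothesis mdens : forall K : set E, compact (K : set 'rV[R]_N) -> K `<=` Omega ->
  exists Z lam f, measurable Z /\ forall i, has_density K Z lam (f i) (m i).

Local Notation TV := (Defs.total_variation Omega m).

Lemma total_variation_compact (K : set E) :
  compact (K : set 'rV[R]_N) -> K `<=` Omega ->
  exists M : {measure set E -> \bar R},
    (forall A, measurable A -> A `<=` K -> M A = TV A) /\ M K < +oo.
Proof.
move=> cK KO; have [Z [lam [f [mZ fd]]]] := mdens cK KO.
have mK := compact_borel cK.
have tvd := has_density_total_variation mK mZ (sub_compactly_contained cK KO) fd.
have [M ME] := has_density_measure mK mZ tvd (fun x _ => l2norm_ge0 _).
exists M; split.
  by move=> A mA AK; rewrite ME// (setIidl AK).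
by rewrite ME// setIid ltey_eq (has_density_fin mK mZ tvd).
Qed.

Let cell (B : set E) := (l2norm (fun i => fine (m i B)))%:E.

Let cell_le (B : set E) : measurable B -> compactly_contained B Omega -> cell B <= TV B.
Proof.
move=> mB [cB BO]; have [Z [lam [f [mZ fd]]]] := mdens cB BO.
apply: (l2norm_le_total_variation (compact_borel cB) mZ (sub_compactly_contained cB BO) fd) => //.
exact: subset_closure.
Qed.

(** On each compact the total variation is a measure, by its density. These local measures are
    summed over a disjointed exhaustion, and the sum is compared with the supremum over partitions
    on arbitrary Borel sets, where it may be infinite. *)
Theorem total_variation_measure : exists M : {measure set E -> \bar R},
  (forall B, measurable B -> TV B = M B) /\ M (~` Omega) = 0.
Proof.
have [K [cK KO Kle UK]] := compact_exhaustion oOmega.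
have mK n : measurable (K n) by exact: compact_borel.
have /choice[M0 M0E] : forall n, exists M : {measure set E -> \bar R},
    forall A : set E, measurable A -> A `<=` K n -> M A = TV A.
  by move=> n; have [M []] := total_variation_compact (cK n) (@KO n); exists M.
pose D : nat -> set E := seqDU K.
have mD n : measurable (D n) by apply: seqDU_measurable.
have DK n : D n `<=` K n by exact: subset_seqDU.
have UD : \bigcup_n D n = Omega by rewrite /D -seqDU_bigcup_eq.
have tD : trivIset setT D by exact: trivIset_seqDU.
pose M : {measure set E -> \bar R} := mseries (fun n => mrestr (M0 n) (mD n)) 0.
have ME B : measurable B -> M B = \sum_(n <oo) TV (B `&` D n).
  move=> mB; rewrite /M /= /mseries; apply: eq_eseriesr => n _.
  rewrite /= /mrestr M0E//; first exact: measurableI.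
  by move=> x [_ /DK].
(* M is assembled from the slices D n, but on any compact L the measure attached to L also equals
   TV; additivity of the latter over the slices identifies the two. *)
have MC (L B : set E) : compact (L : set 'rV[R]_N) -> L `<=` Omega -> measurable B ->
    B `<=` L -> TV B = M B.
  move=> cL LO mB BL; have [ML [MLE _]] := total_variation_compact cL LO.
  rewrite ME// -MLE//.
  have BE : B = \bigcup_n (B `&` D n).
    by rewrite -setI_bigcupr UD; apply/esym/setIidPl/(subset_trans BL).
  rewrite [in LHS]BE measure_bigcup_nat//; last 2 first.
  - by move=> n; exact: measurableI.
  - exact: trivIset_setIl.
  apply: eq_eseriesr => n _; rewrite MLE//; first exact: measurableI.
  by move=> x [/BL].
have Mout : M (~` Omega) = 0.
  rewrite /M /= /mseries eseries0// => n _ _; rewrite /= /mrestr.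
  by rewrite (_ : _ `&` _ = set0) ?measure0//; apply/seteqP; split=> // x [nO /DK/KO].
exists M; split=> // B mB; apply/eqP; rewrite eq_le; apply/andP; split.
  apply: ge_ereal_sup => _ [P [mP cP tP UP] <-].
  have mO : measurable (Omega : set E) by exact: open_borel.
  rewrite (_ : M B = M (B `&` Omega)); last first.
    rewrite (measureDI M mB mO) [X in X + _](_ : _ = 0) ?add0e//.
    apply/eqP; rewrite eq_le measure_ge0 andbT -Mout le_measure ?inE//.
    - exact: measurableD.
    - exact: measurableC.
  rewrite -UP measure_bigcup_nat//.
  apply: lee_nneseries => h _; first by rewrite lee_fin sqrtr_ge0.
  have [c1 c2] := cP h.
  rewrite -(MC (closure (P h)))//; last exact: subset_closure.
  exact: cell_le.
(* The reverse inequality on B [&] K n, letting n tend to infinity at the end: a partition of B [&]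
   K n has to be completed to an admissible partition of B [&] Omega. *)
have mono n : M (B `&` K n) <= TV B.
  have mBK : measurable (B `&` K n) by exact: measurableI.
  rewrite -(MC (K n) _ (cK n) (@KO n) mBK (@subIsetr _ _ _)).
  apply: ge_ereal_sup => _ [P [mP cP tP UP] <-].
  pose Q h := (B `\` K n) `&` D h.
  (* Interleaving: even indices carry the given partition, odd ones the slices of the remainder, so
     that W is again a sequence. *)
  pose W j := if odd j then Q j./2 else P j./2.
  have mQ h : measurable (Q h) by apply: measurableI => //; exact: measurableD.
  have PBK h : P h `<=` B `&` K n.
    by move=> x Px; have : (\bigcup_h P h) x by [exists h]; rewrite UP => -[].
  have tW : trivIset setT W.
    apply/trivIsetP => i j _ _ ij; apply/seteqP; split=> // x [].
    rewrite /W; case: ifPn => oi; case: ifPn => oj.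
    - move=> [_ Di] [_ Dj]; move/trivIsetP : tD => /(_ i./2 j./2 Logic.I Logic.I) <-; first by split; [exact: Di|].
      by apply: contra ij => /eqP E; rewrite -(odd_double_half i) -(odd_double_half j) oi oj E.
    - by move=> [[_ nK] _] /PBK[].
    - by move=> /PBK[_ xK] [[]].
    - move=> Pi Pj; move/trivIsetP : tP => /(_ i./2 j./2 Logic.I Logic.I) <-; first by split; [exact: Pi|].
      by apply: contra ij => /eqP E; rewrite -(odd_double_half i) -(odd_double_half j) (negbTE oi) (negbTE oj) E.
  have UW : \bigcup_j W j = B `&` Omega.
    apply/seteqP; split=> x.
      move=> [j _]; rewrite /W; case: ifP => _.
        by move=> [[Bx _] /DK/KO].
      by move=> /PBK[Bx /KO].
    move=> [Bx Ox]; have [xK|nxK] := pselect (K n x).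
      have : (\bigcup_h P h) x by rewrite UP; split => //; split.
      by move=> [h _ Ph]; exists h.*2 => //; rewrite /W odd_double doubleK.
    move: Ox; rewrite -UD => -[h _ Dh]; exists h.*2.+1 => //.
    by rewrite /W /= odd_double /= uphalf_double.
  have WTV : \sum_(j <oo) cell (W j) <= TV B.
    apply: ereal_sup_ubound; exists W => //; split => //.
    - by move=> j; rewrite /W; case: ifP.
    - move=> j; rewrite /W; case: ifP => _ //.
      by apply: (sub_compactly_contained (cK j./2)) => // x [_ /DK].
  apply: le_trans WTV; apply: lime_le.
    by apply: is_cvg_nneseries => h _ _; rewrite lee_fin sqrtr_ge0.
  apply: nearW => k.
  (* The first 2k cells of W include the first k cells of P, and the others contribute nonnegative
     terms. *)
  have step : \sum_(0 <= h < k) cell (P h) <= \sum_(0 <= j < k.*2) cell (W j).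
    elim: k => [|k IH]; first by rewrite !big_nil.
    rewrite big_nat_recr//= doubleS !big_nat_recr//= -addeA; apply: leeD => //.
    rewrite /W /= odd_double /= doubleK.
    by rewrite leeDl// lee_fin l2norm_ge0.
  apply: le_trans step _.
  by apply: nneseries_lim_ge => j _ _; rewrite lee_fin l2norm_ge0.
have UBK : \bigcup_n (B `&` K n) = B `&` Omega by rewrite -setI_bigcupr UK.
have cvM : M (B `&` K n) @[n --> \oo] --> M (B `&` Omega).
  rewrite -UBK; apply: nondecreasing_cvg_mu.
  - by move=> n; exact: measurableI.
  - by rewrite UBK; apply: measurableI => //; exact: open_borel.
  - by move=> n k nk; apply/subsetPset; apply: setIS; exact: Kle.
have -> : M B = M (B `&` Omega).
  have mO : measurable (Omega : set E) by exact: open_borel.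
  rewrite (measureDI M mB mO) [X in X + _](_ : _ = 0) ?add0e//.
  apply/eqP; rewrite eq_le measure_ge0 andbT -Mout le_measure ?inE//.
  - exact: measurableD.
  - exact: measurableC.
rewrite -(cvg_lim _ cvM)//; apply: lime_le; first by apply/cvg_ex; eexists; exact: cvM.
exact: nearW.
Qed.

End TotalVariationMeasure.
End GlobalMeasure.

(** * Negligible sets, weakly continuous functions and frames *)

Lemma continuous_sum (X : topologicalType) (R : realType) (I : Type) (r : seq I)
    (F : I -> X -> R) :
  (forall i, continuous (F i)) -> continuous (fun x => \sum_(i <- r) F i x).
Proof.
move=> cF; elim: r => [|i r IH] x.
  by under eq_fun do rewrite big_nil; exact: cvg_cst.
by under eq_fun do rewrite big_cons; apply: cvgD; [exact: cF|exact: IH].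
Qed.

Lemma closure_sub (X : topologicalType) (A C : set X) :
  closed C -> A `<=` C -> closure A `<=` C.
Proof. by move=> cC AC; rewrite closureEbigcap => x; apply. Qed.

Section EuclideanTopology.
Context (R : realType) (N : nat).
Local Notation E := 'rV[R]_N.

Lemma enorm_ge0 (x : E) : 0 <= enorm x.
Proof. exact: sqrtr_ge0. Qed.

Lemma sqr_enorm (x : E) : enorm x ^+ 2 = \sum_(i < N) x ord0 i ^+ 2.
Proof. exact: (sqr_l2norm (x ord0)). Qed.

Lemma coord_le_enorm (x : E) i : `|x ord0 i| <= enorm x.
Proof. exact: (l2norm_coord (x ord0)). Qed.

Lemma enorm0 : enorm (0 : E) = 0.
Proof. by rewrite /enorm big1 ?sqrtr0// => i _; rewrite mxE expr0n. Qed.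

Lemma enorm_eq0 (x : E) : enorm x = 0 -> x = 0.
Proof. by move=> x0; apply/rowP => i; rewrite mxE; exact: l2norm_eq0 x0 i. Qed.

Lemma norm_le_enorm (x : E) : `|x| <= enorm x.
Proof.
rewrite [`|x|]mx_normrE; apply: bigmax_le => [|[i j] _]; first exact: enorm_ge0.
by rewrite /= (ord1 i) coord_le_enorm.
Qed.

Lemma enorm_sub_continuous (x : E) : continuous (fun y : E => enorm (y - x)).
Proof.
move=> y; apply: (@continuous_comp _ _ _
    (fun y : E => \sum_(i < N) (y - x) ord0 i ^+ 2)); last exact: sqrt_continuous.
apply: continuous_sum => i z.
have cz : (w - x) ord0 i @[w --> z] --> (z - x) ord0 i.
  rewrite !mxE; under eq_fun do rewrite !mxE.
  exact: (cvgB (@coord_continuous R 1 N ord0 i z) (cvg_cst (x ord0 i))).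
by under eq_fun do rewrite expr2; exact: (cvgM cz cz).
Qed.

Lemma eball_nbhs (x : E) (r : R) : 0 < r -> nbhs x (eball x r).
Proof.
move=> r0.
have h : nbhs (enorm (x - x)) [set s : R | s < r].
  by rewrite subrr enorm0; apply: open_nbhs_nbhs; split => //; exact: open_lt.
exact: (@enorm_sub_continuous x x _ h).
Qed.

(** The sup norm is at most the Euclidean one, so a Euclidean ball lies in the closed library ball
    of the same radius, which is compact. *)
Lemma eball_near (x : E) (U : set E) (P : E -> Prop) : open U -> U x ->
  (\forall y \near x, P y) ->
  exists r, [/\ 0 < r, compactly_contained (eball x r) U &
    forall y, eball x r y -> P y].
Proof.
move=> oU Ux nP.
have : nbhs x (U `&` P) by apply: filterI => //; exact: open_nbhs_nbhs.
move=> /nbhs_closedballP[r] rUP.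
have sub : eball x r%:num `<=` closed_ball x r%:num.
  move=> y xy; apply: subset_closure; rewrite -ball_normE /= distrC.
  exact: le_lt_trans (norm_le_enorm _) xy.
exists r%:num; split => //; last by move=> y /sub/rUP[].
split; last first.
  apply: subset_trans (closureS sub) _.
  rewrite -(closure_id _).1; last exact: closed_ball_closed.
  by move=> y /rUP[].
apply: bounded_closed_compact; last exact: closed_closure.
have := closureS sub; rewrite -(closure_id (closed_ball _ _)).1; last exact: closed_ball_closed.
move=> sub2; exists (`|x| + r%:num); split; first exact: num_real.
move=> M xM y /sub2; rewrite closed_ballE// /closed_ball_ /= => xy.
rewrite (le_trans _ (ltW xM))//.
rewrite -[y](subrK x) addrC (le_trans (ler_normD _ _))// lerD2l distrC//.
Qed.

Lemma ediam_closure (A : set E) : ediam (closure A) = ediam A.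
Proof.
apply/eqP; rewrite eq_le; apply/andP; split; last first.
  apply: le_ereal_sup => _ [x Ax [y Ay <-]].
  by exists x; [exact: subset_closure|exists y => //; exact: subset_closure].
have cle (y : E) (d : R) : closed [set x : E | enorm (x - y) <= d].
  have -> : [set x : E | enorm (x - y) <= d] =
      (fun x : E => enorm (x - y)) @^-1` [set r : R | r <= d] by [].
  by apply: preimage_closed => [x _|]; [exact: enorm_sub_continuous|exact: closed_le].
have enormC (x y : E) : enorm (x - y) = enorm (y - x).
  by rewrite /enorm; congr Num.sqrt; apply: eq_bigr => i _; rewrite !mxE -sqrrN opprB.
apply: ge_ereal_sup => _ [x cx [y cy <-]].
case dE : (ediam A) => [d| |]; last 2 first.
- by rewrite leey.
- have [A0|/set0P[z Az]] := eqVneq A set0.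
    by move: cx; rewrite A0 closure0.
  have : ((enorm (z - z))%:E <= ediam A)%E.
    by apply: ereal_sup_ubound; exists z => //; exists z.
  by rewrite dE.
rewrite lee_fin.
(* The bound by d is a closed condition in each variable; it passes to the closure one variable at a
   time. *)
have H1 z : A z -> enorm (x - z) <= d.
  move=> Az; apply: (closure_sub (cle z d) _ cx) => w Aw /=.
  by rewrite -lee_fin -dE; apply: ereal_sup_ubound; exists w => //; exists z.
rewrite enormC; apply: (closure_sub (cle x d) _ cy) => z Az /=.
by rewrite enormC; exact: H1.
Qed.

Lemma diam_pow_closure k (A : set E) : diam_pow k (closure A) = diam_pow k A.
Proof.
rewrite /diam_pow ediam_closure.
have [->|A0] := eqVneq A set0; first by rewrite closure0 eqxx.
by rewrite ifN//; apply: contra A0 => /eqP/closure_eq0 ->.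
Qed.

Lemma diam_pow_ge0 k (A : set E) : (0 <= diam_pow k A)%E.
Proof.
rewrite /diam_pow; have [//|/set0P[x Ax]] := eqVneq A set0.
apply: expe_ge0; apply: ereal_sup_ubound; exists x => //; exists x => //.
by rewrite subrr enorm0.
Qed.

(** Near-optimal covers may be replaced by their closures without changing diameters or costs. The
    intersection over the meshes 1/(n+1) of the unions of these closed sets is Borel and admits the
    same covers as A. *)
Lemma hnegligible_borel_hull (A : set E) : hnegligible A ->
  exists T : set (borel_rV R N), [/\ measurable T, A `<=` T & hnegligible T].
Proof.
rewrite /hnegligible /hausdorff; set k := N.-1 => A0.
pose cov (B : set E) (d : R) := [set C : nat -> set E | B `<=` \bigcup_h C h /\
   forall h, (ediam (C h) <= d%:E)%E].
pose cost (C : nat -> set E) := (\sum_(h <oo) diam_pow k (C h))%E.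
have cost_ge0 C : (0 <= cost C)%E by apply: nneseries_ge0 => h _ _; exact: diam_pow_ge0.
pose eps n : R := n.+1%:R^-1.
have eps0 n : 0 < eps n by rewrite invr_gt0.
have /choice[C CP] : forall n : nat, exists C, cov A (eps n) C /\ (cost C < (eps n)%:E)%E.
  move=> n.
  have : (ereal_inf [set cost C | C in cov A (eps n)] <= 0)%E.
    rewrite -A0; apply: ereal_sup_ubound; exists (eps n) => //; exact: eps0.
  move=> le0; have : (ereal_inf [set cost C | C in cov A (eps n)] < (eps n)%:E)%E.
    by rewrite (le_lt_trans le0)// lte_fin eps0.
  by move=> /ereal_inf_lt[_ [C CC <-] Cn]; exists C.
pose T : set E := \bigcap_n \bigcup_h closure (C n h).
exists T; split.
- apply: bigcapT_measurable => n; apply: bigcupT_measurable => h.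
  rewrite -[X in measurable X]setCK; apply: measurableC; apply: sub_sigma_algebra.
  by rewrite openC; exact: closed_closure.
- move=> x Ax n _; have [[AC _] _] := CP n.
  by have [h _ Ch] := AC _ Ax; exists h => //; exact: subset_closure.
- apply/eqP; rewrite eq_le; apply/andP; split.
    apply: ge_ereal_sup => _ [d /= d0 <-]; apply/lee_addgt0Pr => e e0.
    rewrite add0e.
    (* The n-th cover has mesh and cost at most 1/(n+1), which must lie below both the mesh d and
       the error e. *)
    pose n := maxn (Num.truncn d^-1) (Num.truncn e^-1).
    have nd : (eps n) <= d.
      rewrite /eps invf_ple ?posrE// ltW// (lt_le_trans (truncnS_gt _))// ler_nat ltnS leq_maxl//.
    have ne : (eps n) <= e.
      rewrite /eps invf_ple ?posrE// ltW// (lt_le_trans (truncnS_gt _))// ler_nat ltnS leq_maxr//.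
    have [[AC Cd] Cn] := CP n.
    apply: (@le_trans _ _ (cost (fun h => closure (C n h)))).
      apply: ereal_inf_lbound; exists (fun h => closure (C n h)) => //.
      split; first by move=> x; apply.
      by move=> h; rewrite ediam_closure (le_trans (Cd h))// lee_fin.
    rewrite /cost; under eq_eseriesr do rewrite diam_pow_closure.
    by apply: ltW; apply: lt_le_trans Cn _; rewrite lee_fin.
  (* For the lower bound 0 any mesh will do, since all costs are nonnegative; mesh 1 is taken. *)
  apply: (@le_trans _ _ (ereal_inf [set cost C | C in cov T 1])).
    by apply: le_ereal_inf_tmp => _ [D _ <-].
  by apply: ereal_sup_ubound; exists 1; [exact: ltr01|].
Qed.

Lemma hnegligible_sub (A B : set E) : B `<=` A -> hnegligible A -> hnegligible B.
Proof.
move=> BA A0; apply/eqP; rewrite eq_le; apply/andP; split.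
  rewrite -A0; apply: ge_ereal_sup => _ [d /= d0 <-].
  apply: le_trans (ereal_sup_ubound _); last by exists d.
  apply: ereal_inf_le_tmp => _ [C [AC Cd] <-]; exists C => //; split => //.
  exact: subset_trans AC.
apply: (@le_trans _ _ (ereal_inf [set (\sum_(h <oo) diam_pow N.-1 (C h))%E | C in
  [set C : nat -> set E | B `<=` \bigcup_h C h /\ forall h, (ediam (C h) <= 1%:E)%E]])).
  by apply: le_ereal_inf_tmp => _ [C _ <-]; apply: nneseries_ge0 => h _ _; exact: diam_pow_ge0.
by apply: ereal_sup_ubound; exists 1; [exact: ltr01|].
Qed.

End EuclideanTopology.

Section WithinContinuous.

Lemma within_open_preimage (X Y : topologicalType) (A : set X) (f : X -> Y) (V : set Y) :
  {within A, continuous f} -> open V ->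
  exists2 U, open U & f @^-1` V `&` A = U `&` A.
Proof.
move=> cf oV.
have : open (from_subspace A f @^-1` V) by apply: open_comp => // x _; exact: cf.
by move=> /open_subspaceP[U oU UE]; exists U => //; rewrite -UE.
Qed.

Lemma within_continuous_borel (X Y : ptopologicalType) (A D : set X) (f : X -> Y) :
  {within A, continuous f} -> D `<=` A -> measurable (D : set (borel X)) ->
  measurable_fun (D : set (borel X)) (f : borel X -> borel Y).
Proof.
move=> cf DA mD; apply: (@measurability _ _ (borel X) (borel Y) D f (@open Y)); first by [].
move=> _ [V oV <-].
have [U oU UE] := within_open_preimage cf oV.
rewrite (_ : _ `&` _ = (D : set (borel X)) `&` U).
  by apply: measurableI => //; exact: open_borel.
apply/seteqP; split => x /= [Dx].
  by move=> Vx; split => //; have [] : (U `&` A) x by rewrite -UE; split => //; exact: DA.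
by move=> Ux; split => //; have [] : (f @^-1` V `&` A) x by rewrite UE; split => //; exact: DA.
Qed.

(** Counterpart of [within_continuous_borel] for real functions: the target carries the
    sigma-algebra of R, generated here by open intervals. *)
Lemma within_continuous_measurable (X : ptopologicalType) (R : realType)
    (A D : set X) (f : X -> R) :
  {within A, continuous f} -> D `<=` A -> measurable (D : set (borel X)) ->
  measurable_fun (D : set (borel X)) (f : borel X -> R).
Proof.
move=> cf DA mD.
apply: (measurability _ (RGenOpens.measurableE R)).
move=> _ [_ [a [b ->] <-]].
have [U oU UE] := within_open_preimage cf (interval_open (a := BRight a) (b := BLeft b) isT isT).
rewrite (_ : _ `&` _ = (D : set (borel X)) `&` U).
  by apply: measurableI => //; exact: open_borel.
apply/seteqP; split => x /= [Dx].
  by move=> Vx; split => //; have [] : (U `&` A) x by rewrite -UE; split => //; exact: DA.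
by move=> Ux; split => //; have [] : (f @^-1` `]a, b[%classic `&` A) x by rewrite UE; split => //; exact: DA.
Qed.

End WithinContinuous.

Section Cwo.
Context (R : realType) (N : nat).
Local Notation E := (borel_rV R N).

(** Compactness in its near-covering form, with the bound C tending to infinity as the parameter,
    makes the local bounds uniform on K. *)
Lemma Cwo_bounded (Omega S : set 'rV[R]_N) (f : 'rV[R]_N -> R) (K : set 'rV[R]_N) :
  Cwo Omega S f -> compact K -> K `<=` Omega ->
  exists C, forall x, (K `\` S) x -> `|f x| <= C.
Proof.
move=> [_ _ bf] cK KO.
have := (compact_near_coveringP K).1 cK R (pinfty_nbhs R)
  (fun C x => ~ S x -> `|f x| <= C) _.
have nb x : K x -> \forall x' \near x & C \near +oo, (~ S x' -> `|f x'| <= C).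
  move=> Kx; have [r [r0 _ [C fC]]] := bf x (KO x Kx).
  exists (eball x r, [set C' | C <= C']); first split => //=.
  - exact: eball_nbhs.
  - by apply: nbhs_pinfty_ge; exact: num_real.
  - by move=> [y C'] [/= xy CC'] nS; rewrite (le_trans (fC y _)).
move=> /(_ _ nb) [C [_ CP]]; exists (C + 1) => x [Kx nS].
by apply: (CP (C + 1)) => //=; rewrite ltrDl.
Qed.

Lemma Cwo_measurable (Omega S : set 'rV[R]_N) (f : 'rV[R]_N -> R) (K Z : set E) :
  Cwo Omega S f -> measurable K -> measurable Z -> K `&` S `<=` Z -> K `<=` Omega ->
  measurable_fun (K `\` Z) (f : E -> R).
Proof.
move=> [_ cf _] mK mZ SZ KO; apply: (within_continuous_measurable cf).
  by move=> x [Kx nZ]; split; [exact: KO|move=> Sx; apply/nZ/SZ].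
exact: measurableD.
Qed.

End Cwo.

(** * Continuous orthonormalization *)

Section ContinuousMatrices.
Context (X : topologicalType) (R : realType).

Definition continuous_mx m n (A : X -> 'M[R]_(m, n)) :=
  forall i j, continuous (fun x => A x i j).

Lemma continuous_mx_mul m n p (A : X -> 'M[R]_(m, n)) (B : X -> 'M[R]_(n, p)) :
  continuous_mx A -> continuous_mx B -> continuous_mx (fun x => A x *m B x).
Proof.
move=> cA cB i j x; under eq_fun do rewrite mxE.
by apply: continuous_sum => k y; exact: (cvgM (cA i k y) (cB k j y)).
Qed.

Lemma continuous_mx_scale m n (a : X -> R) (A : X -> 'M[R]_(m, n)) :
  continuous a -> continuous_mx A -> continuous_mx (fun x => a x *: A x).
Proof.
by move=> ca cA i j x; under eq_fun do rewrite mxE; exact: (cvgM (ca x) (cA i j x)).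
Qed.

Lemma continuous_mx_sub m n (A B : X -> 'M[R]_(m, n)) :
  continuous_mx A -> continuous_mx B -> continuous_mx (fun x => A x - B x).
Proof.
move=> cA cB i j x; under eq_fun do rewrite !mxE.
exact: (cvgB (cA i j x) (cB i j x)).
Qed.

Lemma continuous_mx_block m1 m2 n1 n2 (A : X -> 'M[R]_(m1, n1)) (B : X -> 'M[R]_(m1, n2))
    (C : X -> 'M[R]_(m2, n1)) (D : X -> 'M[R]_(m2, n2)) :
  continuous_mx A -> continuous_mx B -> continuous_mx C -> continuous_mx D ->
  continuous_mx (fun x => block_mx (A x) (B x) (C x) (D x)).
Proof.
move=> cA cB cC cD i j x.
case: (fintype.split_ordP i) => i' ->; case: (fintype.split_ordP j) => j' ->.
- by under eq_fun do rewrite block_mxEul; exact: cA.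
- by under eq_fun do rewrite block_mxEur; exact: cB.
- by under eq_fun do rewrite block_mxEdl; exact: cC.
- by under eq_fun do rewrite block_mxEdr; exact: cD.
Qed.

Definition posdef n (A : 'M[R]_n) :=
  A^T = A /\ forall p : 'rV[R]_n, p != 0 -> 0 < (p *m A *m p^T) ord0 ord0.

(* block Cholesky: eliminate the first row with a Schur complement *)
Lemma continuous_orthonormalization n (A : X -> 'M[R]_n) :
  continuous_mx A -> (forall x, posdef (A x)) ->
  exists2 L : X -> 'M[R]_n, continuous_mx L &
    forall x, L x *m A x *m (L x)^T = 1%:M.
Proof.
elim: n A => [|n IH] A cA pA.
  exists (fun=> 0); first by move=> [].
  by move=> x; apply/matrixP => -[].
pose A' x : 'M[R]_(1 + n) := A x.
pose a x := A x ord0 ord0.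
pose B x : 'rV[R]_n := ursubmx (A' x).
pose D x : 'M[R]_n := drsubmx (A' x).
have AE x : A' x = block_mx (a x)%:M (B x) (B x)^T (D x).
  have sA : (A' x)^T = A' x by have [] := pA x.
  rewrite /B /D trmx_ursub sA -[LHS]submxK; congr block_mx.
  apply/matrixP => i j; rewrite !ord1 !mxE /= mulr1n /a /A'.
  by congr (A x _ _); apply/val_inj.
have a0 x : 0 < a x.
  have [_ /(_ (delta_mx ord0 ord0))] := pA x.
  rewrite -rowE trmx_delta -colE !mxE; apply.
  by apply/eqP => /matrixP/(_ ord0 ord0); rewrite !mxE !eqxx /= => /eqP; rewrite oner_eq0.
have ca : continuous a by exact: cA.
have cB : continuous_mx B.
  move=> i j; under [X in continuous X]eq_fun do rewrite /B !mxE.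
  exact: cA.
have cBT : continuous_mx (fun x => (B x)^T).
  by move=> i j; under [X in continuous X]eq_fun do rewrite mxE; exact: cB.
have cD : continuous_mx D.
  move=> i j; under [X in continuous X]eq_fun do rewrite /D !mxE.
  exact: cA.
have cV : continuous (fun x => (a x)^-1).
  by move=> x; apply: cvgV; [rewrite gt_eqF|exact: ca].
pose S x := D x - (a x)^-1 *: ((B x)^T *m B x).
have cS : continuous_mx S.
  apply: continuous_mx_sub => //; apply: continuous_mx_scale => //.
  exact: continuous_mx_mul.
have pS x : posdef (S x).
  have [sA pAx] := pA x.
  have DT : (D x)^T = D x by rewrite /D trmx_drsub; congr drsubmx.
  split; first by rewrite /S linearB /= linearZ /= trmx_mul trmxK DT.
  (* The completion of q for which the first block of the product cancels: the quadratic form at (c,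
     q) is then that of the Schur complement at q. *)
  move=> q q0; set c := - (a x)^-1 *: (q *m (B x)^T).
  have p0 : row_mx c q != 0 :> 'rV[R]_(1 + n).
    apply: contra q0 => /eqP p0; rewrite -[q](row_mxKr c) p0.
    by apply/eqP/matrixP => i j; rewrite !mxE.
  have := pAx (row_mx c q) p0; rewrite -[A x]/(A' x) AE.
  rewrite (@mul_row_block _ _ 1%N n 1%N n).
  rewrite (@tr_row_mx _ 1%N 1%N n) (@mul_row_col _ 1%N 1%N n 1%N).
  rewrite mul_mx_scalar {1}/c scalerA mulrN mulfV ?gt_eqF// scaleN1r addNr mul0mx add0r.
  rewrite (_ : c *m B x + q *m D x = q *m S x)//.
  by rewrite /c /S mulmxBr -scalemxAl -scalemxAr mulmxA scaleNr addrC.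
have [L' cL' L'E] := IH S cS pS.
pose s x := (Num.sqrt (a x))^-1.
have cs : continuous s.
  move=> x; apply: cvgV; first by rewrite gt_eqF// sqrtr_gt0.
  exact: (continuous_comp (ca x) (@sqrt_continuous R _)).
have ss x : s x * a x * s x = 1.
  rewrite /s -[X in _ * X * _](@sqr_sqrtr _ (a x)); last exact: ltW.
  have h : Num.sqrt (a x) != 0 by rewrite gt_eqF// sqrtr_gt0.
  by field.
(* Lower triangular: the first row normalizes the first basis vector, and the lower left block
   removes the component along it before L' orthonormalizes the Schur complement. *)
exists (fun x => block_mx (s x)%:M 0 (- (a x)^-1 *: (L' x *m (B x)^T)) (L' x)
    : 'M[R]_(1 + n)).
  apply: (@continuous_mx_block 1%N n 1%N n (fun x => (s x)%:M) (fun=> 0)) => //.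
  - move=> i j; under [X in continuous X]eq_fun do rewrite !ord1 mxE eqxx mulr1n.
    exact: cs.
  - by move=> i j; under [X in continuous X]eq_fun do rewrite mxE; exact: cst_continuous.
  - apply: continuous_mx_scale; last exact: continuous_mx_mul.
    by move=> x; apply: cvgN; exact: cV.
move=> x; rewrite -[A x]/(A' x) AE.
rewrite (@mulmx_block _ 1%N n 1%N n 1%N n) (@tr_block_mx _ 1%N n 1%N n).
rewrite (@mulmx_block _ 1%N n 1%N n 1%N n).
rewrite !mul0mx !addr0 tr_scalar_mx trmx0 !mulmx0 !addr0.
rewrite (_ : _ *m (a x)%:M + L' x *m (B x)^T = 0); last first.
  by rewrite mul_mx_scalar scalerA mulrN mulfV ?gt_eqF// scaleN1r addNr.
rewrite !mul0mx add0r.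
rewrite (_ : _ *m B x + L' x *m D x = L' x *m S x); last first.
  by rewrite /S mulmxBr -scalemxAr -scalemxAl mulmxA scaleNr addrC.
rewrite L'E -!scalar_mxM ss.
rewrite (_ : _ + _ = 0); last first.
  rewrite linearZ /= trmx_mul trmxK mul_scalar_mx scalerA mul_scalar_mx -scalemxAl.
  rewrite mulrN mulfK ?gt_eqF// scaleNr addNr//.
by rewrite -scalar_mx_block.
Qed.

End ContinuousMatrices.

(** * Charts and transition maps *)

Section ChartFacts.
Context (R : realType) (N : nat) (X : ptopologicalType) (c : chart R N X).
Hypothesis hc : is_chart c.

Lemma cmapK x : cdom c x -> cinv c (cmap c x) = x.
Proof. by case: hc => _ h _ _; exact: h. Qed.

Lemma cinvK y : (cmap c @` cdom c) y -> cmap c (cinv c y) = y.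
Proof. by move=> [x cx <-]; rewrite cmapK. Qed.

(** Reading images under the chart as preimages under its inverse reduces openness and measurability
    of images to continuity of [cinv]. *)
Lemma cmap_image (A : set X) : A `<=` cdom c ->
  cmap c @` A = cinv c @^-1` A `&` (cmap c @` cdom c).
Proof.
move=> Ac; apply/seteqP; split=> y /=.
  by move=> [x Ax <-]; rewrite cmapK; [split => //; exists x => //; exact: Ac|exact: Ac].
by move=> [Ay cy]; exists (cinv c y) => //; rewrite cinvK.
Qed.

Lemma cmap_open (A : set X) : open A -> A `<=` cdom c -> open (cmap c @` A).
Proof.
case: hc => -[_ ocd] _ _ cinvc oA Ac; rewrite cmap_image//.
have [U oU ->] := within_open_preimage cinvc oA.
exact: openI.
Qed.

Lemma cmap_borel (B : set (borel X)) : measurable B -> B `<=` cdom c ->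
  measurable (cmap c @` B : set (borel_rV R N)).
Proof.
case: hc => -[_ ocd] _ _ cinvc mB Bc; rewrite cmap_image// setIC.
have := @within_continuous_borel _ X _ (cmap c @` cdom c) (cinv c) cinvc.
move=> /(_ (@subset_refl _ _) (open_borel (ocd : open (cmap c @` cdom c : set 'rV[R]_N)))).
by apply => //; exact: open_borel.
Qed.

Lemma cmap_measurable : measurable_fun (cdom c : set (borel X)) (cmap c : borel X -> borel_rV R N).
Proof.
case: hc => -[odc _] _ cc _.
by apply: (within_continuous_borel cc) => //; exact: open_borel.
Qed.

End ChartFacts.

Section Manifold.
Context (R : realType) (N : nat) (M : DC0_manifold R N) (Omega : set M).
Hypothesis oOmega : open Omega.
Implicit Types a b : Defs.index M.

Local Notation E := 'rV[R]_N.

Lemma atlasP a : is_chart (atlas a). Proof. exact: atlas_chart. Qed.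

Lemma dom_open a : open (dom a).
Proof. by have [[]] := atlasP a. Qed.

Lemma cOmega_open a : open (cOmega Omega a).
Proof.
apply: (cmap_open (atlasP a)); last by move=> x [].
by apply: openI => //; exact: dom_open.
Qed.

Lemma overlap_open a b : open (overlap Omega a b).
Proof.
apply: (cmap_open (atlasP a)); last by move=> x [[]].
by apply: openI => //; apply: openI; exact: dom_open.
Qed.

Lemma overlap_cOmega a b : overlap Omega a b `<=` cOmega Omega a.
Proof. by move=> _ [x [[ax bx] Ox] <-]; exists x. Qed.

Lemma overlap_trans a b x : overlap Omega a b x ->
  overlap Omega b a (trans a b x) /\ trans b a (trans a b x) = x.
Proof.
move=> [y [[ay by_] Oy] <-].
have E : trans a b (phi a y) = phi b y.
  by rewrite /trans /transition /= (cmapK (atlasP a)).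
rewrite E; split; first by exists y.
by rewrite /trans /transition /= (cmapK (atlasP b)).
Qed.

Lemma csing_dom a y : dom a y -> csing a (phi a y) <-> @sing R N M y.
Proof.
move=> ay; split; last by exists y.
move=> [z [az sz] E]; rewrite -(cmapK (atlasP a) ay) -/(phi a) -E.
by rewrite (cmapK (atlasP a)).
Qed.

Lemma overlap_csing a b x : overlap Omega a b x ->
  csing b (trans a b x) <-> csing a x.
Proof.
move=> [y [[ay by_] Oy] <-].
rewrite csing_dom// /trans /transition /= (cmapK (atlasP a))//.
exact: csing_dom.
Qed.

Lemma trans_within a b : {within overlap Omega a b, continuous (trans a b)}.
Proof.
have [_ _ _ ca] := atlasP a; have [_ _ cb _] := atlasP b.
rewrite continuous_open_subspace//; last exact: overlap_open.
move=> _ /[!inE] -[y [[ay by_] Oy] <-].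
apply: continuous_comp.
  move: ca; rewrite continuous_open_subspace; last by have [[]] := atlasP a.
  by apply; rewrite inE; exists y.
rewrite -/(phi a) (cmapK (atlasP a))//.
move: cb; rewrite continuous_open_subspace; last exact: dom_open.
by apply; rewrite inE.
Qed.

Lemma overlap_DC0 a b x : overlap Omega a b x -> ~ csing a x ->
  forall j : 'I_N, differentiable (fun x => trans a b x ord0 j : R^o) x.
Proof.
move=> [y [[ay by_] Oy] <-] ns j.
have [_ d _] := @atlas_DC0 _ _ M a b j.
by apply: d; split => //; exists y.
Qed.

Lemma csing_hull a : exists T : set (borel_rV R N),
  [/\ measurable T, csing a `<=` T & hnegligible T].
Proof. exact: hnegligible_borel_hull (atlas_sing a). Qed.

(** The ball given in U may leave V, hence the smaller radius from [eball_near]. *)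
Lemma Cwo_sub (U V S : set E) (f : E -> R) : open V -> V `<=` U -> Cwo U S f -> Cwo V S f.
Proof.
move=> oV VU [hS cf bf]; split => //.
  by apply: continuous_subspaceW cf => x [Vx nS]; split => //; exact: VU.
move=> x Vx; have [r [r0 cr [C rC]]] := bf x (VU x Vx).
have [s [s0 cs sr]] := eball_near oV Vx (eball_nbhs x r0).
by exists s; split => //; exists C => y [/sr sy nS]; apply: rC.
Qed.

Lemma overlap_Cwo a b i j :
  Cwo (overlap Omega a b) (csing a) (partial (fun x => trans a b x ord0 j) i).
Proof.
have [_ _ /(_ i)] := @atlas_DC0 _ _ M a b j.
apply: Cwo_sub; first exact: overlap_open.
by move=> _ [y [[ay by_] Oy] <-]; exists y.
Qed.

Lemma metric_Cwo a i j : Cwo (cOmega Omega a) (csing a) (fun x => metric a x i j).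
Proof.
have [_] := @metric_BV0 _ _ M a i j.
apply: Cwo_sub; first exact: cOmega_open.
by move=> _ [y [ay Oy] <-]; exists y.
Qed.

Lemma metric_posdef a x : (cOmega Omega a `\` csing a) x -> posdef (metric a x).
Proof.
move=> [[y [ay Oy] <-] ns].
have xD : (cmap (atlas a) @` (cdom (atlas a) `\` @sing R N M)) (phi a y).
  by exists y => //; split => //; apply: contra_not ns => sy; exists y.
split; first exact: (@Defs.metric_sym _ _ M a _ xD).
move=> p p0; have [c [c0 _ _ cP]] := @metric_elliptic _ _ M a.
have /andP[h _] := cP _ p xD; apply: lt_le_trans h; apply: mulr_gt0.
  by apply: c0; exists y.
rewrite exprn_gt0// lt_def enorm_ge0 andbT.
by apply: contra p0 => /eqP/enorm_eq0 ->.
Qed.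

Lemma orthonormal_frame_exists a : exists F, orthonormal_frame Omega a F.
Proof.
set D := cOmega Omega a `\` csing a.
(* In the subspace topology the points off D are isolated, so completing the metric by the identity
   there yields a matrix field continuous and positive definite everywhere. *)
pose G (x : subspace D) : 'M[R]_N := if x \in D then metric a x else 1%:M.
have cG : continuous_mx G.
  move=> i j; have [_ cm _] := @metric_Cwo a i j.
  apply: (@subspace_eq_continuous _ D _ (fun x => metric a x i j)) => //.
  by move=> x xD; rewrite /G /from_subspace xD.
have pG x : posdef (G x).
  rewrite /G; case: ifPn => [/set_mem|_]; first exact: metric_posdef.
  split; first by rewrite trmx1.
  move=> p p0; rewrite mulmx1 (_ : (_ *m _) _ _ = enorm p ^+ 2).
    rewrite exprn_gt0// lt_def enorm_ge0 andbT.
    by apply: contra p0 => /eqP/enorm_eq0 ->.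
  by rewrite sqr_enorm mxE; apply: eq_bigr => i _; rewrite mxE -expr2.
have [L cL LE] := continuous_orthonormalization cG pG.
pose F (i : 'I_N) (x : E) : E := row i (L x).
have orth x : D x -> forall i j, (F i x *m metric a x *m (F j x)^T) ord0 ord0 = (i == j)%:R.
  move=> Dx i j; have /matrixP/(_ i j) := LE x; rewrite {1}/G mem_set// [RHS]mxE => <-.
  rewrite /F -row_mul; rewrite tr_row !mxE; apply: eq_bigr => k _.
  by rewrite !mxE.
exists F; split => // i j; split.
- exact: atlas_sing.
- rewrite (_ : (fun x => _) = (fun x => L x i j)); first exact: cL.
  by apply/funext => x; rewrite /F mxE.
(* Ellipticity at a g-unit vector gives c |F_i|^2 <= 1, so the local bound on the inverse of c
   bounds the frame. *)
- move=> x Ux; have [c [c0 _ cV cP]] := @metric_elliptic _ _ M a.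
  have [C nC] : exists C : R, \forall y \near x, `|(c y)^-1| <= C.
    by apply: cV; case: Ux => y [ay _] <-; exists y.
  have [r [r0 rc rC]] := eball_near (@cOmega_open a) Ux nC.
  exists r; split => //; exists (Num.sqrt C) => y [ry ns].
  have Uy : cOmega Omega a y by case: rc => _; apply; exact: subset_closure.
  apply: le_trans (coord_le_enorm _ _) _.
  have Cy := rC y ry.
  have C0 : 0 <= C by rewrite (le_trans _ Cy).
  rewrite /enorm ler_sqrt// -sqr_enorm.
  have yD : (cmap (atlas a) @` (cdom (atlas a) `\` @sing R N M)) y.
    move: ns; case: Uy => z [az _] <- ns.
    by exists z => //; split => //; apply: contra_not ns => sz; exists z.
  have cy0 : 0 < c y by apply: c0; case: yD => z [az _] <-; exists z.
  have /andP[h _] := cP y (F i y) yD.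
  move: h; rewrite orth// eqxx /= mulrC -ler_pdivlMr// div1r => h.
  by apply: le_trans h _; rewrite (le_trans _ Cy)// ler_norm.
Qed.

Lemma frameP a : orthonormal_frame Omega a (frame Omega a).
Proof.
have [F FP] := orthonormal_frame_exists a.
exact: (@xgetI _ (fun _ _ => 0) (orthonormal_frame Omega a) F FP).
Qed.

End Manifold.

(** * Jacobians of transition maps and change of frame *)

Section Jacobians.
Context (R : realType) (n m : nat).

Lemma differentiable_row (F : 'rV[R]_n -> 'rV[R]_m) x :
  (forall j, differentiable (fun z => F z ord0 j : R^o) x) -> differentiable F x.
Proof.
move=> dF.
have -> : F = (fun z => \sum_(j < m) (F z ord0 j) *: (delta_mx ord0 j : 'rV[R]_m)).
  by apply/funext => z; rewrite [LHS]row_sum_delta.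
rewrite (_ : (fun z => _) = \sum_(j < m) (fun z => F z ord0 j *: (delta_mx ord0 j : 'rV[R]_m))).
  by apply: differentiable_sum => j; apply: differentiableZl; exact: dF.
by apply/funext => z; rewrite fct_sumE.
Qed.

Lemma jacobian_partial (F : 'rV[R]_n -> 'rV[R]_m) x i j : differentiable F x ->
  'J F x i j = partial (fun z => F z ord0 j : R^o) i x.
Proof.
move=> dF; have dv : derivable F x (delta_mx ord0 i) by exact: diff_derivable.
transitivity (('D_(delta_mx ord0 i) F x) ord0 j).
  by rewrite deriveEjacobian// -rowE [RHS]mxE.
apply/esym; rewrite /partial /derive; apply: cvg_lim => //.
have cj := @coord_continuous R 1 m ord0 j (derive F x (delta_mx ord0 i)).
have := cvg_comp _ _ dv cj.
apply: cvg_trans; apply: near_eq_cvg; near=> h.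
by rewrite /= !mxE.
Unshelve. all: by end_near. Qed.

End Jacobians.

(** The chain rule for G o F, which is the identity near x. Jacobians act on row vectors, so that of
    F stands on the left. *)
Lemma jacobian_inverse (R : realType) (n : nat) (F G : 'rV[R]_n -> 'rV[R]_n) x :
  differentiable F x -> differentiable G (F x) ->
  (\forall z \near x, G (F z) = z) -> 'J F x *m 'J G (F x) = 1%:M.
Proof.
move=> dF dG GF.
have key (v : 'rV[R]_n) : v *m ('J F x *m 'J G (F x)) = v.
  rewrite mulmxA -deriveEjacobian// deriveE//.
  rewrite /jacobian mul_rV_lin1 -[LHS]/(('d G (F x) \o 'd F x) v) -diff_comp//.
  rewrite -deriveE; last exact: differentiable_comp.
  by rewrite (@near_eq_derive _ _ _ (G \o F) id) ?derive_id.
by apply/row_matrixP => i; rewrite rowE key row1.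
Qed.

Section CongruentMatrices.
Context (R : realType) (N : nat).
Implicit Types G H J A B : 'M[R]_N.

(** The transformation law of the Riemannian volume density: det G is (det J)^2 det H, and |det J|
    |det J'| is 1. *)
Lemma congruent_sqrt_det G H J J' : G = J *m H *m J^T -> J *m J' = 1%:M ->
  Num.sqrt (\det G) * `|\det J'| = Num.sqrt (\det H).
Proof.
move=> -> /(congr1 determinant); rewrite det1 !det_mulmx det_tr => de.
rewrite (_ : _ * \det H * _ = \det J ^+ 2 * \det H); last by ring.
by rewrite sqrtrM ?sqr_ge0// sqrtr_sqr mulrAC -normrM de normr1 mul1r.
Qed.

(** Orthonormality of B makes H B^T its inverse, which forces O = A J H B^T; orthogonality follows
    because A J is orthonormal for H. *)
Lemma congruent_orthonormal G H J A B : G = J *m H *m J^T ->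
  A *m G *m A^T = 1%:M -> B *m H *m B^T = 1%:M ->
  exists O : 'M[R]_N, O *m O^T = 1%:M /\ A *m J = O *m B.
Proof.
move=> GE AE BE.
have BV : (H *m B^T) *m B = 1%:M by apply: mulmx1C; rewrite mulmxA.
have OB : (A *m J *m H *m B^T) *m B = A *m J.
  by rewrite -!mulmxA [H *m _]mulmxA BV mulmx1.
move: OB; set O := A *m J *m H *m B^T => OB; exists O; split=> //.
have : A *m J *m H *m (A *m J)^T = 1%:M by rewrite -AE GE trmx_mul !mulmxA.
by rewrite -OB trmx_mul !mulmxA -(mulmxA O) -(mulmxA O) BE mulmx1.
Qed.

End CongruentMatrices.

Section ManifoldJacobians.
Context (R : realType) (N : nat) (M : DC0_manifold R N) (Omega : set M).
Hypothesis oOmega : open Omega.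
Implicit Types a b : Defs.index M.

Lemma trans_differentiable a b x : overlap Omega a b x -> ~ csing a x ->
  differentiable (trans a b) x.
Proof.
by move=> ox ns; apply: differentiable_row => j; exact: (overlap_DC0 ox ns).
Qed.

(** The entries of ['J] are identified with partial derivatives only off the singular set, where the
    map is differentiable; hence a separate function f with the [Cwo] property. *)
Lemma jacobian_trans_Cwo a b i j : exists2 f : 'rV[R]_N -> R,
  Cwo (overlap Omega a b) (csing a) f &
  forall x, (overlap Omega a b `\` csing a) x -> 'J (trans a b) x i j = f x.
Proof.
exists (partial (fun x => trans a b x ord0 j) i); first exact: overlap_Cwo.
move=> x [ox ns]; apply: jacobian_partial; exact: trans_differentiable.
Qed.

Lemma jacobian_transK a b x : overlap Omega a b x -> ~ csing a x ->
  'J (trans a b) x *m 'J (trans b a) (trans a b x) = 1%:M.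
Proof.
move=> ox ns; have [oFx GF] := overlap_trans ox.
apply: jacobian_inverse.
- exact: trans_differentiable.
- by apply: trans_differentiable => //; rewrite (overlap_csing ox).
- apply: (@filterS _ _ _ (overlap Omega a b)); first by move=> z /overlap_trans[].
  by apply: open_nbhs_nbhs; split => //; exact: overlap_open.
Qed.

Lemma metric_trans a b x : overlap Omega a b x -> ~ csing a x ->
  metric a x = 'J (trans a b) x *m metric b (trans a b x) *m ('J (trans a b) x)^T.
Proof.
move=> [y [[ay by_] Oy] <-] ns; apply: Defs.metric_transform.
exists y => //; split => //; apply: contra_not ns => sy.
by exists y.
Qed.

Lemma det_metric_trans a b x : overlap Omega a b x -> ~ csing a x ->
  Num.sqrt (\det (metric a x)) * `|\det ('J (trans b a) (trans a b x))| =
  Num.sqrt (\det (metric b (trans a b x))).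
Proof.
by move=> ox ns; exact: (congruent_sqrt_det (metric_trans ox ns) (jacobian_transK ox ns)).
Qed.

Lemma frame_mx_orthonormal c (z : 'rV[R]_N) : (cOmega Omega c `\` csing c) z ->
  let A := \matrix_i frame Omega c i z in A *m metric c z *m A^T = 1%:M.
Proof.
move=> cz A; have [_ fr] := frameP oOmega c; apply/matrixP => i j.
rewrite [RHS]mxE -(fr z cz i j).
have rA k : frame Omega c k z = row k A by rewrite rowK.
rewrite !rA -row_mul tr_row [LHS]mxE [RHS]mxE; apply: eq_bigr => k _.
by rewrite [row _ _ _ _]mxE [col _ _ _ _]mxE.
Qed.

(** Pushed forward by dF, the frame of chart a is orthonormal for the metric of chart b, hence a
    rotation Q of the frame of b at the image point. *)
Lemma frame_trans a b x : overlap Omega a b x -> ~ csing a x ->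
  exists O : 'M[R]_N, O *m O^T = 1%:M /\
    forall i j, \sum_k frame Omega a i x ord0 k * 'J (trans a b) x k j =
      \sum_l O i l * frame Omega b l (trans a b x) ord0 j.
Proof.
move=> ox ns; have [oFx GF] := overlap_trans ox.
have ax : (cOmega Omega a `\` csing a) x by split => //; exact: overlap_cOmega ox.
have bx : (cOmega Omega b `\` csing b) (trans a b x).
  by split; [exact: overlap_cOmega oFx|rewrite (overlap_csing ox)].
have [Q [QQ QE]] := congruent_orthonormal (metric_trans ox ns)
  (frame_mx_orthonormal ax) (frame_mx_orthonormal bx).
exists Q; split => // i j; have /matrixP/(_ i j) := QE; rewrite [LHS]mxE [RHS]mxE.
under eq_bigr do rewrite mxE; move=> ->.
by apply: eq_bigr => l _; congr (_ * _); rewrite mxE.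
Qed.

End ManifoldJacobians.

Section TensorNorm.
Context (R : realType) (N p : nat).

(** The p-th tensor power of O is orthogonal: distributing products over sums, the scalar product of
    two of its columns is the product of scalar products of columns of O. *)
Lemma tensor_orthogonal (O : 'M[R]_N) (v : {ffun 'I_p -> 'I_N} -> R) :
  O *m O^T = 1%:M ->
  \sum_(i : {ffun 'I_p -> 'I_N})
     (\sum_(l : {ffun 'I_p -> 'I_N}) (\prod_(k < p) O (i k) (l k)) * v l) ^+ 2 =
  \sum_(l : {ffun 'I_p -> 'I_N}) v l ^+ 2.
Proof.
move=> /mulmx1C OtO.
have key (l l' : {ffun 'I_p -> 'I_N}) : \sum_(i : {ffun 'I_p -> 'I_N})
    (\prod_(k < p) O (i k) (l k)) * (\prod_(k < p) O (i k) (l' k)) = (l == l')%:R.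
  under eq_bigr do rewrite -big_split /=.
  rewrite -(bigA_distr_bigA (fun k j => O j (l k) * O j (l' k))).
  transitivity (\prod_(k < p) ((l k == l' k)%:R : R)).
    apply: eq_bigr => k _; have /matrixP/(_ (l k) (l' k)) := OtO.
    by rewrite !mxE => <-; apply: eq_bigr => j _; rewrite mxE.
  have [->|ll'] := eqVneq l l'; first by rewrite big1// => k _; rewrite eqxx.
  have [k kP] : exists k, l k != l' k.
    apply/existsP; rewrite -negb_forall; apply: contra ll' => /forallP H.
    by apply/eqP/ffunP => k; apply/eqP.
  by rewrite (bigD1 k)//= (negbTE kP) mul0r.
under eq_bigr do rewrite expr2 big_distrlr /=.
rewrite exchange_big /=; apply: eq_bigr => l _.
rewrite exchange_big /=.
transitivity (\sum_(l' : {ffun 'I_p -> 'I_N}) v l * v l' * (l == l')%:R).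
  apply: eq_bigr => l' _; rewrite -key mulr_sumr; apply: eq_bigr => i _.
  by rewrite mulrACA mulrC.
rewrite (bigD1 l)//= eqxx mulr1 big1 ?addr0 ?expr2// => l' l'l.
by rewrite eq_sym (negbTE l'l) mulr0.
Qed.

End TensorNorm.

(** * Bounded measurable multipliers *)

Section BoundedMeasurable.
Context d (T : measurableType d) (R : realType) (D : set T).
Implicit Types f g : T -> R.

(** The multipliers by which a density may be changed; the closure properties that follow cover
    products of frame or Jacobian entries and square roots of determinants. *)
Definition bounded_measurable f :=
  measurable_fun D f /\ exists C, forall x, D x -> `|f x| <= C.

Lemma bounded_measurable_eq f g : bounded_measurable f ->
  (forall x, D x -> f x = g x) -> bounded_measurable g.
Proof.
move=> [mf [C fC]] fg; split.
  by apply: eq_measurable_fun mf => x /set_mem Dx; rewrite fg.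
by exists C => x Dx; rewrite -fg// fC.
Qed.

Lemma bounded_measurable_cst c : bounded_measurable (fun=> c).
Proof. by split=> //; exists `|c|. Qed.

Lemma bounded_measurableM f g : bounded_measurable f -> bounded_measurable g ->
  bounded_measurable (fun x => f x * g x).
Proof.
move=> [mf [C fC]] [mg [B gB]]; split; first exact: measurable_funM.
by exists (C * B) => x Dx; rewrite normrM ler_pM// ?fC ?gB.
Qed.

Lemma bounded_measurableD f g : bounded_measurable f -> bounded_measurable g ->
  bounded_measurable (fun x => f x + g x).
Proof.
move=> [mf [C fC]] [mg [B gB]]; split; first exact: measurable_funD.
by exists (C + B) => x Dx; rewrite (le_trans (ler_normD _ _))// lerD// ?fC ?gB.
Qed.

Lemma bounded_measurable_sum (I : Type) (r : seq I) (P : pred I) (f : I -> T -> R) :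
  (forall i, bounded_measurable (f i)) ->
  bounded_measurable (fun x => \sum_(i <- r | P i) f i x).
Proof.
move=> fb; elim: r => [|i r IH].
  by apply: (bounded_measurable_eq (bounded_measurable_cst 0)) => x _; rewrite big_nil.
case: (boolP (P i)) => Pi.
  by apply: (bounded_measurable_eq (bounded_measurableD (fb i) IH)) => x _; rewrite big_cons Pi.
by apply: (bounded_measurable_eq IH) => x _; rewrite big_cons (negbTE Pi).
Qed.

Lemma bounded_measurable_prod (I : Type) (r : seq I) (P : pred I) (f : I -> T -> R) :
  (forall i, bounded_measurable (f i)) ->
  bounded_measurable (fun x => \prod_(i <- r | P i) f i x).
Proof.
move=> fb; elim: r => [|i r IH].
  by apply: (bounded_measurable_eq (bounded_measurable_cst 1)) => x _; rewrite big_nil.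
case: (boolP (P i)) => Pi.
  by apply: (bounded_measurable_eq (bounded_measurableM (fb i) IH)) => x _; rewrite big_cons Pi.
by apply: (bounded_measurable_eq IH) => x _; rewrite big_cons (negbTE Pi).
Qed.

Lemma bounded_measurable_norm f : bounded_measurable f ->
  bounded_measurable (fun x => `|f x|).
Proof.
move=> [mf [C fC]]; split; first exact: measurableT_comp.
by exists C => x Dx; rewrite normr_id fC.
Qed.

Lemma bounded_measurable_sqrt f : bounded_measurable f ->
  bounded_measurable (fun x => Num.sqrt (f x)).
Proof.
move=> [mf [C fC]]; split.
  apply: (measurableT_comp _ mf).
  by apply: continuous_measurable_fun; exact: sqrt_continuous.
exists (Num.sqrt C) => x Dx; rewrite ger0_norm ?sqrtr_ge0// ler_wsqrtr//.
by rewrite (le_trans (ler_norm _))// fC.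
Qed.

Lemma bounded_measurable_det n (A : T -> 'M[R]_n) :
  (forall i j, bounded_measurable (fun x => A x i j)) ->
  bounded_measurable (fun x => \det (A x)).
Proof.
move=> Ab; rewrite /determinant; apply: bounded_measurable_sum => s.
apply: bounded_measurableM; first exact: bounded_measurable_cst.
exact: bounded_measurable_prod.
Qed.

End BoundedMeasurable.

Section Densities.
Local Open Scope ereal_scope.
Context (R : realType) (N : nat).
Local Notation E := (borel_rV R N).

Lemma has_density_mul_bounded (K Z : set E) lam f h mu :
  measurable K -> measurable Z -> has_density K Z lam f mu ->
  bounded_measurable (K `\` Z) h ->
  has_density K Z lam (fun x => h x * f x)%R (density h mu).
Proof. by move=> mK mZ fd [mh [C hC]]; exact: (has_density_mul mK mZ fd mh hC). Qed.

Lemma has_density_integral_bounded (K Z : set E) lam f h mu :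
  measurable K -> measurable Z -> has_density K Z lam f mu ->
  (forall x, (K `\` Z) x -> (0 <= f x)%R) -> bounded_measurable (K `\` Z) h ->
  has_density K Z lam (fun x => h x * f x)%R (fun B => \int[mu]_(x in B) (h x)%:E).
Proof. by move=> mK mZ fd f0 [mh [C hC]]; exact: (has_density_integral mK mZ fd f0 mh hC). Qed.

Lemma Cwo_bounded_measurable (Omega S : set 'rV[R]_N) (f : 'rV[R]_N -> R) (K Z : set E) :
  Cwo Omega S f -> compact (K : set 'rV[R]_N) -> measurable Z -> K `&` S `<=` Z ->
  K `<=` Omega -> bounded_measurable (K `\` Z) f.
Proof.
move=> fC cK mZ SZ KO; split.
  exact: (Cwo_measurable fC (compact_borel cK) mZ SZ KO).
have [C CP] := Cwo_bounded fC cK KO.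
exists C => x [Kx nZ]; apply: CP; split => // Sx; apply: nZ; exact: SZ.
Qed.

Lemma has_density_charge (K Z : set E) lam f mu : measurable K -> measurable Z ->
  has_density K Z lam f mu ->
  exists nu : {charge set E -> \bar R},
    forall B, measurable B -> B `<=` K -> mu B = nu B.
Proof.
move=> mK mZ [fi fE]; have mKZ : measurable (K `\` Z) by exact: measurableD.
have gi : lam.-integrable setT ((EFin \o f) \_ (K `\` Z)).
  exact/(integrable_mkcond _ mKZ).
exists (induced_charge gi) => B mB BK; rewrite fE// /induced_charge /=.
transitivity (\int[lam]_(x in B `&` (K `\` Z)) (EFin \o f) x).
  congr (integral _ _ _); apply/seteqP; split=> x [Bx]; [by move=> nZ; split => //; split => //; exact: BK|by case].
exact: integral_mkcondr.
Qed.

(** Both variations of mu vanish on the Borel subsets of B, as the zero measure does, so the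
    integrals against them are 0 for every h. *)
Lemma density_null (h : E -> R) (mu : set E -> \bar R) (B : set E) :
  measurable B -> (forall A, measurable A -> A `<=` B -> mu A = 0) -> density h mu B = 0.
Proof.
move=> mB mu0; rewrite /density.
have pos0 nu : (forall A, measurable A -> A `<=` B -> nu A = 0) ->
    \int[pos_var nu]_(x in B) (h x)%:E = 0.
  move=> nu0.
  (* For the zero measure the whole space is an admissible exceptional set, which lets h be replaced
     by 0. *)
  rewrite (@raw_integral _ E R (mzero : {measure set E -> \bar R}) _ B setT _ (cst 0))//.
  - by rewrite integral0.
  - rewrite /pos_var => A mA AB; apply/eqP; rewrite eq_le; apply/andP; split.
      by apply: ge_ereal_sup => _ [C [mC CA] <-]; rewrite nu0//; exact: subset_trans AB.
    apply: ereal_sup_ubound; exists set0; first by split.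
    by rewrite nu0.
  - by move=> x _ /(_ Logic.I).
rewrite pos0// /neg_var pos0 ?sube0// => A mA AB.
by rewrite mu0// oppe0.
Qed.

End Densities.

(** * Local norms in two charts *)

Section TensorComposition.
Context (R : realType) (N p : nat).
Local Notation I := {ffun 'I_p -> 'I_N}.

(** Tensor powers are multiplicative: a product over k of sums over m is a sum over
    multi-indices. *)
Lemma tensor_compose (A B C : 'I_N -> 'I_N -> R) (w : I -> R) (i : I) :
  (forall i j, \sum_m A i m * B m j = C i j) ->
  \sum_(j' : I) (\prod_(k < p) A (i k) (j' k)) *
     (\sum_(j : I) (\prod_(k < p) B (j' k) (j k)) * w j) =
  \sum_(j : I) (\prod_(k < p) C (i k) (j k)) * w j.
Proof.
move=> ABC; under eq_bigr do rewrite mulr_sumr.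
rewrite exchange_big /=; apply: eq_bigr => j _.
under eq_bigr do rewrite mulrA -big_split /=.
rewrite -mulr_suml -(bigA_distr_bigA (fun k m => A (i k) m * B m (j k))).
by congr (_ * _); apply: eq_bigr => k _; rewrite ABC.
Qed.

(** By composition the left side involves the tensor power of A J = Q B, that is, the tensor power
    of Q applied to the components in B; the former is an isometry. *)
Lemma l2norm_tensor_change (A J B Q : 'M[R]_N) (w : I -> R) :
  Q *m Q^T = 1%:M ->
  (forall i j, \sum_k A i k * J k j = \sum_l Q i l * B l j) ->
  l2norm (fun i : I => \sum_(j' : I) (\prod_(k < p) A (i k) (j' k)) *
     (\sum_(j : I) (\prod_(k < p) J (j' k) (j k)) * w j)) =
  l2norm (fun i : I => \sum_(j : I) (\prod_(k < p) B (i k) (j k)) * w j).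
Proof.
move=> QQ AJ; rewrite /l2norm; congr Num.sqrt.
rewrite -[RHS](tensor_orthogonal _ QQ); apply: eq_bigr => i _; congr (_ ^+ 2).
by rewrite (tensor_compose _ _ AJ) (tensor_compose _ _ (fun i j => erefl (\sum_l Q i l * B l j))).
Qed.

Lemma l2norm_scale (J : finType) (c : R) (v : J -> R) :
  l2norm (fun i => c * v i) = `|c| * l2norm v.
Proof.
rewrite /l2norm; under eq_bigr do rewrite exprMn.
by rewrite -mulr_sumr sqrtrM ?sqr_ge0// sqrtr_sqr.
Qed.

End TensorComposition.

Section LocalNorm.
Local Open Scope ereal_scope.
Context (R : realType) (N p : nat) (M : DC0_manifold R N) (Omega : set M).
Hypothesis oOmega : open Omega.
Variable S : components M p.
Hypothesis hS : is_tensor Omega S.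
Implicit Types a b : Defs.index M.
Local Notation E := (borel_rV R N).
Local Notation I := {ffun 'I_p -> 'I_N}.

(** Pointwise counterpart of [tensor_eval] along the frame, acting on the densities of the
    components. *)
Definition frame_components a (f : I -> E -> R) (i : I) (x : E) : R :=
  (\sum_(j : I) (\prod_(k < p) frame Omega a (i k) x ord0 (j k)) * f j x)%R.

Lemma has_density_tensor_eval a (K Z : set E) lam f (i : I) :
  compact (K : set 'rV[R]_N) -> K `<=` cOmega Omega a -> measurable Z ->
  K `&` csing a `<=` Z -> (forall j, has_density K Z lam (f j) (S a j)) ->
  has_density K Z lam (frame_components a f i)
    (tensor_eval S a (fun k => frame Omega a (i k))).
Proof.
move=> cK KO mZ KZ fd; have mK := compact_borel cK.
apply: has_density_sum => // j _; apply: has_density_mul_bounded => //.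
apply: bounded_measurable_prod => k.
have [/(_ (i k) (j k)) fC _] := frameP oOmega a.
exact: (Cwo_bounded_measurable fC cK mZ KZ KO).
Qed.

Lemma has_density_local_norm a (K Z : set E) lam f :
  compact (K : set 'rV[R]_N) -> K `<=` cOmega Omega a -> measurable Z ->
  K `&` csing a `<=` Z -> (forall j, has_density K Z lam (f j) (S a j)) ->
  has_density K Z lam (fun x => l2norm (fun i => frame_components a f i x))
    (local_norm Omega S a).
Proof.
move=> cK KO mZ KZ fd; have mK := compact_borel cK.
apply: has_density_total_variation => //.
  exact: (sub_compactly_contained cK KO).
by move=> i; exact: has_density_tensor_eval.
Qed.

Lemma tensor_has_dens a (K T : set E) :
  compact (K : set 'rV[R]_N) -> K `<=` cOmega Omega a ->
  measurable T -> hnegligible T ->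
  exists lam f, forall j, has_density K T lam (f j) (S a j).
Proof.
move=> cK KO mT T0; have mK := compact_borel cK.
have [SG _] := hS.
apply: has_density_Radon_Nikodym => //.
  by move=> j; have [/(_ K cK KO)] := SG a j.
move=> j B mB BK BT; have [_] := SG a j; apply => //.
  exact: (sub_compactly_contained cK KO).
exact: hnegligible_sub T0.
Qed.

Lemma local_norm_measure a : exists m : {measure set E -> \bar R},
  (forall B, measurable B -> local_norm Omega S a B = m B) /\ m (~` cOmega Omega a) = 0.
Proof.
apply: total_variation_measure; first exact: cOmega_open.
move=> K cK KO; have [T [mT sT T0]] := csing_hull a.
have [lam [f fd]] := tensor_has_dens cK KO mT T0.
exists T, lam, (frame_components a f); split => // i.
apply: has_density_tensor_eval => //.
by move=> x [_ /sT].
Qed.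

Lemma local_norm_GM a : GM (cOmega Omega a) (local_norm Omega S a).
Proof.
split=> [K cK KO|B mB cB B0].
  have [T [mT sT T0]] := csing_hull a.
  have [lam [f fd]] := tensor_has_dens cK KO mT T0.
  apply: (has_density_charge (compact_borel cK) mT (has_density_local_norm cK KO mT _ fd)).
  by move=> x [_ /sT].
have [m [mE _]] := local_norm_measure a.
apply/eqP; rewrite eq_le; apply/andP; split; last by rewrite mE.
(* Inside a negligible B the components vanish on every Borel subset of each cell, so every term of
   the sum is 0. *)
apply: ge_ereal_sup => _ [P [mP cP tP UP] <-].
rewrite eseries0// => h _ _; rewrite big1 ?sqrtr0// => i _.
have PB : P h `<=` B.
  by move=> x Px; have : (\bigcup_h P h) x by [exists h]; rewrite UP => -[].
rewrite (_ : tensor_eval _ _ _ _ = 0) ?expr0n//.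
rewrite /tensor_eval big1// => j _; apply: density_null => // A mA AP.
have [SG _] := hS; have [_] := SG a j; apply => //.
  have AB := subset_trans AP PB; case: cB => cB BO.
  apply: (sub_compactly_contained cB BO); exact: subset_trans (@subset_closure _ _).
by apply: hnegligible_sub B0; exact: subset_trans PB.
Qed.

Section Overlap.
Variables (a b : Defs.index M) (K : set E).
Hypotheses (cK : compact (K : set 'rV[R]_N)) (KO : K `<=` overlap Omega a b).

Let F : E -> E := trans a b.
Let G : E -> E := trans b a.
Let V : set E := overlap Omega b a.
Let K' : set E := F @` K.

Let cK' : compact (K' : set 'rV[R]_N).
Proof.
apply: continuous_compact => //.
exact: continuous_subspaceW (@trans_within _ _ _ _ oOmega a b).
Qed.

Let K'V : K' `<=` V.
Proof. by move=> _ [x Kx <-]; have [] := overlap_trans (KO Kx). Qed.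

Let GF x : K x -> G (F x) = x.
Proof. by move=> Kx; have [] := overlap_trans (KO Kx). Qed.

Let FG y : V y -> F (G y) = y.
Proof. by move=> Vy; have [] := overlap_trans Vy. Qed.

Let mK : measurable K. Proof. exact: compact_borel. Qed.
Let mK' : measurable K'. Proof. exact: compact_borel. Qed.

Let mF : measurable_fun K F.
Proof. exact: (within_continuous_borel (@trans_within _ _ _ _ oOmega a b)). Qed.

Let mG : measurable_fun K' G.
Proof. exact: (within_continuous_borel (@trans_within _ _ _ _ oOmega b a)). Qed.

(** Everything is given a density with respect to the image lam' of a single reference measure on
    F(K); both claims then become identities of functions on K off the singular set. *)
Lemma local_norm_compare B : measurable B -> B `<=` K ->
  chart_pullback Omega a b (local_norm Omega S b) B = local_norm Omega S a B /\
  \int[local_norm Omega S a]_(x in B) (Num.sqrt (\det (metric a x)))%:E =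
  \int[local_norm Omega S b]_(y in V `&` G @^-1` B) (Num.sqrt (\det (metric b y)))%:E.
Proof.
move=> mB BK.
have [T [mT sT T0]] := csing_hull b.
have KOa : K `<=` cOmega Omega a by exact: subset_trans (@overlap_cOmega _ _ _ _ a b).
have KOb : K' `<=` cOmega Omega b by exact: subset_trans (@overlap_cOmega _ _ _ _ b a).
have [lam [f fd]] := tensor_has_dens cK' KOb mT T0.
(* Removing T in chart b thus amounts to removing Z in chart a, and Z covers the singular points of
   K because F preserves the singular set. *)
pose Z : set E := K `&` F @^-1` T.
have mZ : measurable Z by exact: mF.
have KZ : K `&` csing a `<=` Z.
  move=> x [Kx sx]; split => //; apply: sT.
  by apply/(overlap_csing (KO Kx)).
have K'T : K' `&` csing b `<=` T by move=> y [_ /sT].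
have [lam' push] : exists lam' : {finite_measure set E -> \bar R}, forall f mu,
    has_density K' T lam f mu -> has_density K Z lam' (f \o F) (push V G mu).
  apply: has_density_push => //.
  - by move=> y Vy Ky; exists (G y) => //; exact: FG.
  - by move=> _ [x Kx <-]; rewrite GF.
  - by move=> y /K'V/FG.
  - by move=> x Kx; split; [exists x|exact: GF].
  - by move=> _ [x Kx <-]; rewrite GF//; split => [[]|].
pose dJ y := (`|\det ('J G y)|)%R.
have dJb : bounded_measurable (K' `\` T) dJ.
  apply: bounded_measurable_norm; apply: bounded_measurable_det => i j.
  have [h hC hE] := @jacobian_trans_Cwo R N M Omega oOmega b a i j.
  apply: (bounded_measurable_eq (Cwo_bounded_measurable hC cK' mT K'T K'V)).
  by move=> y [Ky nT]; rewrite hE//; split; [exact: K'V|move=> /sT].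
have Jb i j : bounded_measurable (K `\` Z) (fun x => 'J F x i j).
  have [h hC hE] := @jacobian_trans_Cwo R N M Omega oOmega a b i j.
  apply: (bounded_measurable_eq (Cwo_bounded_measurable hC cK mZ KZ KO)).
  by move=> y [Ky nZ]; rewrite hE//; split; [exact: KO|move=> sy; apply/nZ/KZ].
(* The densities that the tensor law assigns to the components in chart a; the factor [dJ] comes
   from F^*. *)
pose sa (i : I) x := (\sum_(j : I) (\prod_(k < p) 'J F x (i k) (j k)) *
  (dJ (F x) * f j (F x)))%R.
have sad i : has_density K Z lam' (sa i) (S a i).
  have [_ /(_ a b i) SE] := hS.
  have sd : has_density K Z lam' (sa i) (fun C => \sum_(j : I)
      density (fun x => \prod_(k < p) 'J F x (i k) (j k))%R
        (chart_pullback Omega a b (S b j)) C).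
    apply: has_density_sum => // j _; apply: has_density_mul_bounded => //.
      exact: (push (fun y => dJ y * f j y)%R _ (has_density_mul_bounded mK' mT (fd j) dJb)).
    by apply: bounded_measurable_prod => k; exact: Jb.
  apply: (has_density_eq mK mZ sd) => // C mC CK; rewrite SE//.
  exact: (sub_compactly_contained cK KO).
have lna := has_density_local_norm cK KOa mZ KZ sad.
have lnb := has_density_local_norm cK' KOb mT K'T fd.
have pb := push _ _ (has_density_mul_bounded mK' mT lnb dJb).
have nsing x : (K `\` Z) x -> overlap Omega a b x /\ ~ csing a x.
  by move=> [Kx nZ]; split; [exact: KO|move=> sx; apply/nZ/KZ].
(* Pointwise invariance: the scalar [dJ] leaves the norm, and the change of frame acts on p-tensors
   through the tensor power of the orthogonal Q. *)
have normE x : (K `\` Z) x ->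
    l2norm (fun i => frame_components a sa i x) =
    (dJ (F x) * l2norm (fun i => frame_components b f i (F x)))%R.
  move=> /nsing[ox ns]; have [Q [QQ QE]] := frame_trans oOmega ox ns.
  pose A := (\matrix_(i, j) frame Omega a i x ord0 j)%R.
  pose B' := (\matrix_(i, j) frame Omega b i (F x) ord0 j)%R.
  have QE' i j : (\sum_k A i k * 'J F x k j = \sum_l Q i l * B' l j)%R.
    under eq_bigr do rewrite mxE; rewrite QE.
    by under [RHS]eq_bigr do rewrite mxE.
  have := l2norm_tensor_change (fun j => dJ (F x) * f j (F x))%R QQ QE'.
  have dJ0 : (`|dJ (F x)| = dJ (F x))%R by rewrite /dJ normr_id.
  rewrite (_ : (dJ (F x) * _)%R =
    l2norm (fun i => dJ (F x) * frame_components b f i (F x))%R); last first.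
    by rewrite (l2norm_scale (dJ (F x))) dJ0.
  have -> : (fun i : I => \sum_(j' : I) (\prod_(k < p) A (i k) (j' k)) *
     (\sum_(j : I) (\prod_(k < p) 'J F x (j' k) (j k)) * (dJ (F x) * f j (F x))))%R =
     (fun i => frame_components a sa i x).
    apply/funext => i; apply: eq_bigr => j _; congr (_ * _)%R.
    by apply: eq_bigr => k _; rewrite mxE.
  move=> ->; congr l2norm; apply/funext => i; rewrite /frame_components mulr_sumr.
  apply: eq_bigr => j _; rewrite mulrCA; congr (_ * (_ * _))%R.
  by apply: eq_bigr => k _; rewrite mxE.
split.
  have := has_density_uniq (has_density_eq mK mZ pb _ _) lna mB BK; apply => //.
  by move=> x xK /=; rewrite normE.
have gb c (L Y : set E) : compact (L : set 'rV[R]_N) -> L `<=` cOmega Omega c ->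
    measurable Y -> L `&` csing c `<=` Y ->
    bounded_measurable (L `\` Y) (fun x => Num.sqrt (\det (metric c x))).
  move=> cL LO mY LY; apply: bounded_measurable_sqrt; apply: bounded_measurable_det => i j.
  exact: (Cwo_bounded_measurable (metric_Cwo oOmega c i j) cL mY LY LO).
have Wa := has_density_integral_bounded mK mZ lna (fun x _ => l2norm_ge0 _) (gb a K Z cK KOa mZ KZ).
have Wb := has_density_integral_bounded mK' mT lnb (fun x _ => l2norm_ge0 _) (gb b K' T cK' KOb mT K'T).
have := has_density_uniq Wa (has_density_eq mK mZ (push _ _ Wb) _ (fun _ _ _ => erefl)) mB BK; apply.
(* The factor [dJ] of the norms is absorbed by the transformation law of the volume density. *)
move=> x xK; have [ox ns] := nsing x xK.
rewrite /= normE// mulrA; congr (_ * _)%R.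
exact: (esym (det_metric_trans oOmega ox ns)).
Qed.

End Overlap.
End LocalNorm.

(** * Gluing along a countable atlas *)

Lemma restricted_pushforward d1 d2 (T1 : measurableType d1) (T2 : measurableType d2)
    (R : realType) (mu : {measure set T1 -> \bar R}) (D : set T1) (g : T1 -> T2) :
  measurable D -> measurable_fun D g ->
  exists nu : {measure set T2 -> \bar R}, forall B, nu B = mu (D `&` g @^-1` B).
Proof.
move=> mD mg.
pose g0 : T1 -> T2 := fun y => if y \in D then g y else point.
have mg0 : measurable_fun setT g0 := measurable_extension mD mg.
pose nu_ : {measure set T2 -> \bar R} := pushforward (mrestr mu mD) g0.
exists (nu_ mg0) => B.
rewrite /= /pushforward /mrestr; congr (mu _).
apply/seteqP; split=> y /=; rewrite /g0 => -[].
  by move=> + Dy; rewrite mem_set.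
by move=> Dy; rewrite mem_set.
Qed.

Section CountableAtlas.
Context (R : realType) (N : nat) (M : DC0_manifold R N).

(** Each compact of the sigma-compact carrier meets finitely many domains of a subcover. The
    subcovers are extracted from the chart domains as sets, and indices are chosen back
    afterwards. *)
Lemma countable_atlas : exists s : nat -> Defs.index M, forall x, exists n, dom (s n) x.
Proof.
have [K [cK UK]] := carrier_sigma_compact M.
have cov x : exists a : Defs.index M, dom a x.
  have : (\bigcup_a cdom (@atlas R N M a)) x by rewrite atlas_cover.
  by move=> [a _ ax]; exists a.
have [a0 _] := cov point.
pose Ch := [set U : set M | exists a : Defs.index M, U = dom a].
have fin n : exists r : seq (set M), (forall U, U \in r -> Ch U) /\
    forall x, K n x -> exists2 U, U \in r & U x.
  have := cK n; rewrite compact_cover => /(_ _ Ch id) [].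
  - by move=> _ [a ->]; exact: dom_open.
  - by move=> x _; have [a ax] := cov x; exists (dom a) => //; exists a.
  move=> D DCh KD; exists (finmap.enum_fset D); split.
    by move=> U UD; apply/set_mem/DCh.
  by move=> x /KD[U UD Ux]; exists U.
have /choice[r rP] := fin.
have chart_of U : exists a : Defs.index M, Ch U -> U = dom a.
  by have [[a ->]|nU] := pselect (Ch U); [exists a|exists a0].
have /choice[c cP] := chart_of.
(* n codes a pair (i, j), the j-th domain in the cover of K i; a0 fills the integers that code no
   pair. *)
exists (fun n => if unpickle n is Some (i, j) then c (nth set0 (r i) j) else a0).
move=> x; have : (\bigcup_n K n) x by rewrite UK.
move=> [i _ Kix]; have [rC /(_ x Kix)[U Ur Ux]] := rP i.
exists (pickle (i, seq.index U (r i))); rewrite pickleK nth_index//.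
by rewrite -cP//; exact: rC.
Qed.

End CountableAtlas.

(** * The norm measure read in one chart *)

Section NormMeasure.
Local Open Scope ereal_scope.
Context (R : realType) (N p : nat) (M : DC0_manifold R N) (Omega : set M).
Hypothesis oOmega : open Omega.
Variable S : components M p.
Hypothesis hS : is_tensor Omega S.
Implicit Types a b : Defs.index M.
Local Notation E := (borel_rV R N).

Definition norm_reading a (B : set E) : \bar R :=
  \int[local_norm Omega S a]_(x in B) (Num.sqrt (\det (metric a x)))%:E.

Lemma norm_reading_charge a (K : set E) :
  compact (K : set 'rV[R]_N) -> K `<=` cOmega Omega a ->
  exists nu : {charge set E -> \bar R},
    forall B, measurable B -> B `<=` K -> norm_reading a B = nu B.
Proof.
move=> cK KO; have [T [mT sT T0]] := csing_hull a.
have [lam [f fd]] := tensor_has_dens hS cK KO mT T0.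
have KT : K `&` csing a `<=` T by move=> x [_ /sT].
have mK := compact_borel cK.
have ln := has_density_local_norm oOmega cK KO mT KT fd.
apply: (has_density_charge mK mT (has_density_integral_bounded mK mT ln (fun x _ => l2norm_ge0 _) _)).
apply: bounded_measurable_sqrt; apply: bounded_measurable_det => i j.
exact: (Cwo_bounded_measurable (metric_Cwo oOmega a i j) cK mT KT KO).
Qed.

Lemma norm_reading_null a (B : set E) : measurable B ->
  local_norm Omega S a B = 0 -> norm_reading a B = 0.
Proof.
move=> mB B0; have [m [mE _]] := local_norm_measure oOmega hS a.
rewrite /norm_reading (@raw_integral _ _ _ m _ B B _ (cst 0))//.
- by rewrite integral0.
- by rewrite setIid -mE.
- by move=> A mA _; rewrite mE.
Qed.

(** Densities control the reading on compacts only, whereas the gluing needs countable additivity on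
    all Borel subsets of the open set. The local norm is already a measure m; weighting it off the
    Borel hull T of the singular set provides this. *)
Lemma norm_reading_measure a : exists W : {measure set E -> \bar R},
  forall B : set E, measurable B -> B `<=` cOmega Omega a -> norm_reading a B = W B.
Proof.
have [T [mT sT T0]] := csing_hull a.
have [m [mE mout]] := local_norm_measure oOmega hS a.
have oU : open (cOmega Omega a) by exact: cOmega_open.
have [K [cK KO Kle UK]] := compact_exhaustion oU.
set U : set E := cOmega Omega a in mout KO UK oU *.
have mU : measurable U by exact: open_borel.
have mUT : measurable (U `\` T) by exact: measurableD.
(* The [GM] property speaks of compactly contained sets only, so nullity of T in U is reached along
   the exhaustion by continuity from below. *)
have mT0 : m (T `&` U) = 0.
  have TU : T `&` U = \bigcup_n (T `&` K n) by rewrite -setI_bigcupr UK.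
  rewrite TU; have mTK n : measurable (T `&` K n).
    by apply: measurableI => //; exact: compact_borel.
  have mTU : measurable (\bigcup_n (T `&` K n)) by exact: bigcupT_measurable.
  have mono : {homo (fun n => T `&` K n) : n k / (n <= k)%N >-> (n <= k)%O}.
    by move=> n k nk; apply/subsetPset; apply: setIS; exact: Kle.
  have cv := @nondecreasing_cvg_mu _ _ _ m _ mTK mTU mono.
  rewrite -(cvg_lim _ cv)//; apply: lim_near_cst => //; apply: nearW => n /=.
  rewrite -mE//; have [_] := local_norm_GM oOmega hS a; apply => //.
    by apply: (sub_compactly_contained (cK n) (@KO n)); exact: subIsetr.
  by apply: hnegligible_sub T0; exact: subIsetl.
have mw : measurable_fun (U `\` T) (fun x => (Num.sqrt (\det (metric a x)))%:E).
  apply/measurable_EFinP; apply: (measurableT_comp (f := @Num.sqrt R)).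
    by apply: continuous_measurable_fun; exact: sqrt_continuous.
  rewrite /determinant; apply: measurable_sum => s; apply: measurable_funM => //.
  apply: measurable_prod => i _.
  by apply: (Cwo_measurable (metric_Cwo oOmega a _ _)) => // x [_ /sT].
have [W WE] := measure_of_weight m mUT mw (fun x _ => ltac:(by rewrite lee_fin sqrtr_ge0)).
exists W => B mB BU; rewrite WE /norm_reading.
rewrite (@raw_integral _ _ _ m _ B T _ ((fun x => (Num.sqrt (\det (metric a x)))%:E) \_ (U `\` T)))//.
- by rewrite -integral_mkcondr.
- apply/eqP; rewrite eq_le measure_ge0 andbT -mT0 le_measure ?inE//.
  + exact: measurableI.
  + exact: measurableI.
  + by move=> x [/BU ? ?].
- by move=> A mA _; rewrite mE.
- by move=> x Bx nT; rewrite patchE mem_set//; split => //; exact: BU.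
Qed.

(** The comparison on compacts is summed over disjoint slices of A along an exhaustion of the
    overlap; both readings are countably additive, the one in chart b after transport by
    [trans b a]. *)
Lemma norm_reading_compat a b (A : set E) : measurable A -> A `<=` overlap Omega a b ->
  norm_reading a A = norm_reading b (overlap Omega b a `&` trans b a @^-1` A).
Proof.
move=> mA AO.
have [Wa WaE] := norm_reading_measure a; have [Wb WbE] := norm_reading_measure b.
have mV : measurable (overlap Omega b a : set E) by apply: open_borel; exact: overlap_open.
have mG : measurable_fun (overlap Omega b a : set E) (trans b a : E -> E).
  exact: (within_continuous_borel (trans_within oOmega (a := b) (b := a))).
have [nu nuE] := restricted_pushforward Wb mV mG.
have [K [cK KO Kle UK]] := compact_exhaustion (overlap_open oOmega (a := a) (b := b)).
have mK n : measurable (K n) by exact: compact_borel.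
have mD n : measurable (seqDU K n) by apply: seqDU_measurable.
have sub C : C `<=` A -> C `<=` cOmega Omega a.
  by move=> CA x /CA/AO/overlap_cOmega.
have AE : A = \bigcup_n (A `&` seqDU K n).
  by rewrite -setI_bigcupr -seqDU_bigcup_eq UK; apply/esym/setIidPl.
have Vsub C : overlap Omega b a `&` C `<=` cOmega Omega b.
  by move=> y [/overlap_cOmega].
rewrite (WaE _ mA (sub _ (@subset_refl _ _))) (WbE _ (mG mV _ mA) (Vsub _)) -nuE.
rewrite AE !measure_bigcup_nat; last 4 first.
- by move=> n; exact: measurableI.
- by apply: trivIset_setIl; exact: trivIset_seqDU.
- by move=> n; exact: measurableI.
- by apply: trivIset_setIl; exact: trivIset_seqDU.
apply: eq_eseriesr => n _.
have mAn : measurable (A `&` seqDU K n) by exact: measurableI.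
have AnK : A `&` seqDU K n `<=` K n by apply: subset_trans (@subset_seqDU _ K n); exact: subIsetr.
have [_] := local_norm_compare oOmega hS (cK n) (@KO n) mAn AnK.
rewrite nuE -(WaE _ mAn (sub _ (@subIsetl _ _ _))) -(WbE _ (mG mV _ mAn) (Vsub _)).
by [].
Qed.

End NormMeasure.

Section Gluing.
Local Open Scope ereal_scope.
Context (R : realType) (N p : nat) (M : DC0_manifold R N) (Omega : set M).
Hypothesis oOmega : open Omega.
Variable S : components M p.
Hypothesis hS : is_tensor Omega S.
Implicit Types a b : Defs.index M.
Local Notation E := (borel_rV R N).
Local Notation reading := (norm_reading Omega S).

Lemma phi_image_sub a (A : set M) : A `<=` dom a `&` Omega ->
  phi a @` A `<=` cOmega Omega a.
Proof. by move=> AO _ [x /AO xO <-]; exists x. Qed.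

Lemma phi_borel a (A : set (borel M)) : measurable A -> A `<=` dom a ->
  measurable (phi a @` A : set E).
Proof. exact: (cmap_borel (atlasP a)). Qed.

(** This identifies the set produced by the comparison of readings with the image in the second
    chart, so that the readings become functions of subsets of the manifold. *)
Lemma trans_preimage a b (A : set M) : A `<=` dom a `&` dom b `&` Omega ->
  overlap Omega b a `&` trans b a @^-1` (phi a @` A) = phi b @` A.
Proof.
have transE z : dom b z -> trans b a (phi b z) = phi a z.
  by move=> bz; rewrite /trans /transition /= (cmapK (atlasP b)).
move=> AO; apply/seteqP; split=> y.
  move=> [[z [[bz az] Oz] <-]] /=; rewrite transE// => -[w Aw].
  have [[aw _] _] := AO w Aw => wz; exists w => //.
  by congr (phi b _); rewrite -(cmapK (atlasP a) aw) -/(phi a) wz (cmapK (atlasP a)).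
move=> [z Az <-]; have [[az bz] Oz] := AO z Az.
by split; [exists z|rewrite /= transE//; exists z].
Qed.

Lemma reading_chart a b (A : set (borel M)) : measurable A ->
  A `<=` dom a `&` dom b `&` Omega -> reading a (phi a @` A) = reading b (phi b @` A).
Proof.
move=> mA AO; rewrite (norm_reading_compat oOmega hS (b := b)).
- by rewrite trans_preimage.
- by apply: phi_borel => // x /AO[[]].
- by move=> _ [x /AO xO <-]; exists x.
Qed.

Lemma reading_bigcup a (A : nat -> set (borel M)) : (forall n, measurable (A n)) ->
  trivIset setT A -> (forall n, A n `<=` dom a `&` Omega) ->
  reading a (phi a @` (\bigcup_n A n)) = \sum_(n <oo) reading a (phi a @` A n).
Proof.
move=> mA tA AO; have [W WE] := norm_reading_measure oOmega hS a.
have mphi n : measurable (phi a @` A n : set E).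
  by apply: phi_borel => // x /AO[].
rewrite image_bigcup WE; last 2 first.
- exact: bigcupT_measurable.
- by move=> y [n _]; apply: phi_image_sub.
rewrite measure_bigcup_nat//.
  by apply: eq_eseriesr => n _; rewrite WE//; exact: phi_image_sub.
apply/trivIsetP => i j _ _ ij; apply/seteqP; split=> // y [[x Ax <-] [z Az]].
have [ax _] := AO i x Ax; have [az _] := AO j z Az => zx.
have xz : z = x by rewrite -(cmapK (atlasP a) az) -/(phi a) zx (cmapK (atlasP a)).
move/trivIsetP : tA => /(_ i j Logic.I Logic.I ij) A0.
by have : (A i `&` A j) x; [split=> //; rewrite -xz|rewrite A0].
Qed.

Section Patches.
Variable s : nat -> Defs.index M.
Hypothesis sP : forall x, exists n, dom (s n) x.

Let C : nat -> set (borel M) := seqDU (fun n => dom (s n) : set (borel M)).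

Let mC n : measurable (C n).
Proof. by apply: seqDU_measurable => k; apply: open_borel; exact: dom_open. Qed.

Let Cdom n : C n `<=` dom (s n). Proof. exact: subset_seqDU. Qed.

Let UC : \bigcup_n C n = setT.
Proof.
rewrite -seqDU_bigcup_eq; apply/seteqP; split=> // x _.
by have [n nx] := sP x; exists n.
Qed.

Let tC : trivIset setT C. Proof. exact: trivIset_seqDU. Qed.

Let mO : measurable (Omega : set (borel M)). Proof. exact: open_borel. Qed.

(** On each disjoint patch the reading in its chart is carried back to the manifold by [cinv]; the
    sum of these measures is again a measure. *)
Lemma glued_measure : exists nu : {measure set (borel M) -> \bar R},
  forall B, measurable B ->
    nu B = \sum_(n <oo) reading (s n) (phi (s n) @` (C n `&` Omega `&` B)).
Proof.
have /choice[nu nuE] : forall n, exists nu : {measure set (borel M) -> \bar R},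
    forall B, measurable B -> nu B = reading (s n) (phi (s n) @` (C n `&` Omega `&` B)).
  move=> n; have [W WE] := norm_reading_measure oOmega hS (s n).
  pose D : set E := phi (s n) @` (C n `&` Omega).
  have mD : measurable D.
    by apply: phi_borel; [exact: measurableI|move=> x [/Cdom]].
  have Dd : D `<=` (cmap (atlas (s n)) @` cdom (atlas (s n))).
    by move=> _ [x [/Cdom Cx _] <-]; exists x.
  have mg : measurable_fun D (cinv (atlas (s n)) : E -> borel M).
    have [_ _ _ cc] := atlasP (s n).
    exact: (within_continuous_borel cc Dd mD).
  have [nu nuE] := restricted_pushforward W mD mg.
  exists nu => B mB; rewrite nuE WE.
  - congr (W _); apply/seteqP; split=> y.
      move=> [[x Cx <-]] /=; rewrite /phi (cmapK (atlasP (s n)))// => [Bx|].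
        by exists x.
      by case: Cx => /Cdom.
    move=> [x [Cx Bx] <-]; split; first by exists x.
    by rewrite /= /phi (cmapK (atlasP (s n)))//; case: Cx => /Cdom.
  - by apply: phi_borel => [|x [[/Cdom]]//]; apply: measurableI => //; exact: measurableI.
  - by apply: phi_image_sub => x [[/Cdom]].
exists (mseries nu 0) => B mB; rewrite /= /mseries.
by apply: eq_eseriesr => n _; exact: nuE.
Qed.

Variable nu : {measure set (borel M) -> \bar R}.
Hypothesis nuE : forall B, measurable B ->
  nu B = \sum_(n <oo) reading (s n) (phi (s n) @` (C n `&` Omega `&` B)).

(** B is sliced by the patches; on each slice the reading in the chart of the patch is exchanged for
    that in chart a, and the slices are summed in chart a. *)
Lemma glued_norm_formula : norm_formula Omega S nu.
Proof.
move=> a B mB BO; rewrite nuE//.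
have BE : B = \bigcup_n (C n `&` Omega `&` B).
  rewrite -2!setI_bigcupl UC setTI; apply/esym/setIidPr.
  by move=> x /BO[].
have mCB n : measurable (C n `&` Omega `&` B).
  by apply: measurableI => //; exact: measurableI.
have RE : reading a (phi a @` B) =
    \sum_(n <oo) reading a (phi a @` (C n `&` Omega `&` B)).
  transitivity (reading a (phi a @` (\bigcup_n (C n `&` Omega `&` B)))).
    by congr (norm_reading _ _ _ (_ @` _)).
  apply: reading_bigcup => //.
  - by apply: trivIset_setIr; apply: trivIset_setIr.
  - by move=> n x [[_ Ox] /BO].
apply: etrans (esym RE); apply: eq_eseriesr => n _.
by apply/esym/reading_chart => // x [[/Cdom Cx Ox] /BO[ax _]].
Qed.

Lemma glued_GM : GM_manifold Omega nu.
Proof.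
split.
  rewrite nuE; last exact: measurableC.
  rewrite eseries0// => n _ _; rewrite (_ : _ `&` _ = set0).
    rewrite image_set0; have [W WE] := norm_reading_measure oOmega hS (s n).
    by rewrite WE ?measure0.
  by apply/seteqP; split=> // x [[]].
move=> a.
(* By the norm formula the push-forward to any chart is the reading there, to which the charge and
   null-set properties already apply. *)
have pushE (B : set E) : measurable B -> B `<=` cOmega Omega a ->
    push (dom a `&` Omega) (phi a) nu B = reading a B.
  move=> mB BO.
  have mpre : measurable ((dom a `&` Omega) `&` phi a @^-1` B : set (borel M)).
    rewrite setIAC; apply: measurableI => //.
    apply: (cmap_measurable (atlasP a)) => //.
    by apply: open_borel; exact: dom_open.
  have spre : (dom a `&` Omega) `&` phi a @^-1` B `<=` dom a `&` Omega by exact: subIsetl.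
  rewrite /push (@glued_norm_formula a _ mpre spre).
  congr (norm_reading _ _ a _); apply/seteqP; split=> y; first by move=> [x [_ Bx] <-].
  by move=> By; have [x xO xy] := BO y By; exists x => //; split => //=; rewrite xy.
split=> [K cK KO|B mB [cB BO] B0].
  have [ch chE] := norm_reading_charge oOmega hS cK KO.
  by exists ch => B mB BK; rewrite pushE ?chE//; exact: subset_trans KO.
have BO' : B `<=` cOmega Omega a by exact: subset_trans (@subset_closure _ _) BO.
rewrite pushE//; apply: norm_reading_null => //.
by have [_] := local_norm_GM oOmega hS a; apply.
Qed.

(** Each slice of B by a patch lies in one chart, where the formula fixes the value; countable
    additivity extends this to B. *)
Lemma norm_formula_uniq nu' : norm_formula Omega S nu' ->
  forall B : set (borel M), measurable B -> B `<=` Omega -> nu' B = nu B.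
Proof.
move=> nuF B mB BO.
have BE : B = \bigcup_n (C n `&` B) by rewrite -setI_bigcupl UC setTI.
have mCB n : measurable (C n `&` B) by exact: measurableI.
have tCB : trivIset setT (fun n => C n `&` B) by exact: trivIset_setIr.
rewrite BE !measure_bigcup_nat//; apply: eq_eseriesr => n _.
have sub : C n `&` B `<=` dom (s n) `&` Omega by move=> x [/Cdom Cx /BO].
by rewrite (nuF (s n) _ (mCB n) sub) (@glued_norm_formula (s n) _ (mCB n) sub).
Qed.

End Patches.
End Gluing.

Theorem lemma4p23 (R : realType) (N p : nat) (hN : (0 < N)%N)
    (M : DC0_manifold R N) (Omega : set M) (oOmega : open Omega)
    (S : components M p) (hS : is_tensor Omega S) :
  [/\ (forall a, exists m : {measure set (borel_rV R N) -> \bar R},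
         forall B, measurable B -> local_norm Omega S a B = m B),
      GM_system Omega (local_norm Omega S) &
      exists nu : {measure set (borel M) -> \bar R},
        [/\ norm_formula Omega S nu, GM_manifold Omega nu &
            forall nu' : {measure set (borel M) -> \bar R},
              norm_formula Omega S nu' ->
              forall B : set (borel M), measurable B -> B `<=` Omega ->
                nu' B = nu B]].
Proof.
split.
- by move=> a; have [m [mE _]] := local_norm_measure oOmega hS a; exists m.
- split; first exact: local_norm_GM.
  (* The comparison is applied on the compact closure of B. *)
  move=> a b B mB [cB BO].
  by have [] := local_norm_compare oOmega hS cB BO mB (@subset_closure _ B).
- have [s sP] := countable_atlas M.
  have [nu nuE] := glued_measure oOmega hS s.
  exists nu; split.
  + exact: (glued_norm_formula oOmega hS sP nuE).
  + exact: (glued_GM oOmega hS sP nuE).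
  + exact: (norm_formula_uniq oOmega hS sP nuE).
Qed.
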